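(* Suppose that the basic regularity assumptions on $f,\psi_\ell,\phi_\ell$ and the quadratic majorization assumption (both stated in the context) hold. Let $(\mathbf{x}^k)_{k\in\mathbb{N}}$ be a sequence generated by the Gauss-Seidel algorithm CO-GS described in the context, and suppose that: (a) $\bigcup_{i=0}^{I_k-1}J_i^k=\{1,\dots,L\}$ for all $k$; (b) there is $\bar I\in\mathbb{N}^*$ with $0<I_k\le\bar I$ for all $k$; (c) $\Psi$ is bounded from below and the iterates generated by the algorithm (outer and inner) are bounded; (d) $\Psi$ satisfies the Kurdyka-Łojasiewicz property at every $\mathbf{x}\in\operatorname{dom}\Psi$; (e) for every $k$ and every $i\in\{0,\dots,I_k-1\}$ the majorant $\Psi_k$ is strongly convex with respect to the variables $(x_\ell)_{\ell\in J_i^k}$ with modulus $\mu_{k,i}>0$, and there is $\underline\mu>0$ with $\mu_{k,i}\ge\underline\mu$ for all $k,i$. Then: (i) $\sum_{k=0}^{+\infty}\|\mathbf{x}^{k+1}-\mathbf{x}^k\|<+\infty$. (ii) $(\mathbf{x}^k)_{k\in\mathbb{N}}$ converges to a critical point $\widehat{\mathbf{x}}$ of $\Psi$, i.e. $0\in\partial\Psi(\widehat{\mathbf{x}})$.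
   Context: Setting. $\mathcal{H}=\mathcal{H}_1\times\dots\times\mathcal{H}_L$ is the direct sum of finite-dimensional real Hilbert spaces, $\mathbf{x}=(x_1,\dots,x_L)$, $\|\mathbf{x}\|^2=\sum_\ell\|x_\ell\|^2$. The objective is $\Psi=f+g$ with $g(\mathbf{x})=\sum_{\ell=1}^L\phi_\ell(\psi_\ell(x_\ell))$. $\nabla_\ell f$ is the gradient with respect to block $\ell$. $\partial$ is the limiting (Mordukhovich) subdifferential (equal to the usual subdifferential for convex functions). Basic regularity assumptions. $f$ is continuously differentiable on $\mathcal H$ and there are $\beta_{\ell,j}>0$ with $\|\nabla_\ell f(\mathbf{x}+(0,\dots,0,v_j,0,\dots,0))-\nabla_\ell f(\mathbf{x})\|\le\beta_{\ell,j}\|v_j\|$ for all $\ell,j$, $\mathbf{x}\in\mathcal{H}$, $v_j\in\mathcal{H}_j$. For each $\ell$: $\psi_\ell:\mathcal{H}_\ell\to[0,+\infty]$ is convex, proper, lower semicontinuous and Lipschitz continuous on its domain; $\phi_\ell:[0,+\infty]\to(-\infty,+\infty]$ is concave, strictly increasing and differentiable on $[0,+\infty)$, with $\phi_\ell'$ locally Lipschitz continuous on its domain. Quadratic majorization assumption. For every $\mathbf{y}\in\mathcal{H}$ and $J\subseteq\{1,\dots,L\}$ there are symmetric operators $A_{\mathbf y,\ell}$ on $\mathcal{H}_\ell$, $\ell\in J$, with $\underline\nu\,\mathrm{Id}\preceq A_{\mathbf y,\ell}\preceq\overline\nu\,\mathrm{Id}$ for constants $\underline\nu,\overline\nu>0$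 independent of $\mathbf{y},J$, such that for every $x=(x_\ell)_{\ell\in J}$, $f(x\mid y_{\overline{J}})\le f(\mathbf{y})+\sum_{\ell\in J}\big(\langle x_\ell-y_\ell,\nabla_\ell f(\mathbf{y})\rangle+\tfrac12\langle x_\ell-y_\ell,A_{\mathbf y,\ell}(x_\ell-y_\ell)\rangle\big)$, where $f(x\mid y_{\overline J})$ is the value of $f$ when blocks in $J$ are $x_\ell$ and the others are $y_\ell$. Majorant. Given $\mathbf{x}^k$ with $\psi_\ell(x_\ell^k)<+\infty$ for all $\ell$, let $\lambda_{\ell,k}=\phi'_\ell(\psi_\ell(x^k_\ell))$ and $\Psi_k(\mathbf{x})=f(\mathbf{x})+\sum_{\ell=1}^L\big[\phi_\ell(\psi_\ell(x_\ell^k))+\lambda_{\ell,k}(\psi_\ell(x_\ell)-\psi_\ell(x_\ell^k))\big]$. ''Strongly convex with respect to $(x_\ell)_{\ell\in J}$'' means strongly convex as a function of these blocks when the remaining blocks are held fixed (at values where the corresponding $\psi_\ell$ are finite). Algorithm CO-GS. Start from $\mathbf{x}^0\in\operatorname{dom}\Psi$ with $\psi_\ell(x^0_\ell)<+\infty$ for all $\ell$. For $k=0,1,\dots$: set $\tilde{\mathbf{x}}^k_0=\mathbf{x}^k$. For $i=0,\dots,I_k-1$, given $J_i^k\subseteq\{1,\dots,L\}$, let $(\tilde x_{i+1,\ell}^k)_{\ell\in J_i^k}$ be a minimizer of $\Psi_k$ with respect to the blocks in $J_i^k$, the other blocks being fixed to those of $\tilde{\mathbf{x}}_i^k$, with $\tilde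 x_{i+1,\ell}^k=\tilde x_{i,\ell}^k$ for $\ell\notin J_i^k$ and $\tilde{\mathbf{x}}_{i+1}^k\in\operatorname{dom}\Psi$. Then set $\mathbf{x}^{k+1}=\tilde{\mathbf{x}}_{I_k}^k$. Kurdyka-Łojasiewicz (KŁ) property of $\Psi$ at $\tilde{\mathbf{u}}$: there exist $r\in(0,+\infty]$, a neighborhood $U$ of $\tilde{\mathbf{u}}$ and a concave continuous $\varphi:[0,r)\to[0,+\infty)$ with $\varphi(0)=0$, $\varphi$ of class $C^1$ on $(0,r)$ and $\varphi'>0$ there, such that for all $\mathbf{u}\in U$ with $\Psi(\tilde{\mathbf{u}})<\Psi(\mathbf{u})<\Psi(\tilde{\mathbf{u}})+r$ one has $\varphi'(\Psi(\mathbf{u})-\Psi(\tilde{\mathbf{u}}))\,\mathrm{dist}(0,\partial\Psi(\mathbf{u}))\ge1$. *)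

(* Defs.v *)
From HB Require Import structures.
From mathcomp Require Import all_boot all_order all_algebra.
From mathcomp Require Import all_classical all_reals all_analysis.
From mathcomp Require Import ring.

Set Implicit Arguments.
Unset Strict Implicit.
Unset Printing Implicit Defensive.

Import Order.TTheory GRing.Theory Num.Theory.
Import numFieldNormedType.Exports.

Local Open Scope classical_set_scope.
Local Open Scope ring_scope.

(* A real inner product space is a normed module whose norm is induced by a
   positive definite symmetric form; a Euclidean space is moreover
   finite-dimensional, hence a Hilbert space. *)
HB.mixin Record hasInner (R : realType) V & NormedModule R V := {
  inner : {dot V for (@idfun R)};
  sqr_normE : forall x : V, `|x| ^+ 2 = inner x x
}.

#[short(type="innerType")]
HB.structure Definition InnerSpace (R : realType) :=
  {V of NormedModule R V & hasInner R V}.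

#[short(type="euclideanType")]
HB.structure Definition Euclidean (R : realType) :=
  {V of InnerSpace R V & Vector R V}.

(* Hilbert direct sum of the blocks: its norm is the l2 norm of the block norms
   (the product topology instance of the library carries no norm). *)
Definition hsum (R : realType) (L : nat) (H : 'I_L -> euclideanType R) : Type :=
  forall l, H l.

Section hsum.
Context {R : realType} {L : nat} {H : 'I_L -> euclideanType R}.
Implicit Types x y z : hsum H.

HB.instance Definition _ := gen_eqMixin (hsum H).
HB.instance Definition _ := gen_choiceMixin (hsum H).

Let hadd x y : hsum H := fun l => x l + y l.
Let hopp x : hsum H := fun l => - x l.
Let hzero : hsum H := fun l => 0.
Let hscale (a : R) x : hsum H := fun l => a *: x l.

Let haddA : associative hadd.
Proof. by move=> x y z; apply: functional_extensionality_dep => l; exact: addrA. Qed.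
Let haddC : commutative hadd.
Proof. by move=> x y; apply: functional_extensionality_dep => l; exact: addrC. Qed.
Let hadd0 : left_id hzero hadd.
Proof. by move=> x; apply: functional_extensionality_dep => l; exact: add0r. Qed.
Let haddN : left_inverse hzero hopp hadd.
Proof. by move=> x; apply: functional_extensionality_dep => l; exact: addNr. Qed.

HB.instance Definition _ :=
  GRing.isZmodule.Build (hsum H) haddA haddC hadd0 haddN.

Let hscaleA a b x : hscale a (hscale b x) = hscale (a * b) x.
Proof. by apply: functional_extensionality_dep => l; exact: scalerA. Qed.
Let hscale1 : left_id 1 hscale.
Proof. by move=> x; apply: functional_extensionality_dep => l; exact: scale1r. Qed.
Let hscaleDr : right_distributive hscale +%R.
Proof. by move=> a x y; apply: functional_extensionality_dep => l; exact: scalerDr. Qed.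
Let hscaleDl x : {morph hscale^~ x : a b / a + b}.
Proof. by move=> a b; apply: functional_extensionality_dep => l; exact: scalerDl. Qed.

HB.instance Definition _ :=
  GRing.Zmodule_isLmodule.Build R (hsum H) hscaleA hscale1 hscaleDr hscaleDl.

Lemma hsum0E l : (0 : hsum H) l = 0. Proof. by []. Qed.
Lemma hsumDE x y l : (x + y) l = x l + y l. Proof. by []. Qed.
Lemma hsumNE x l : (- x) l = - x l. Proof. by []. Qed.
Lemma hsumZE (a : R) x l : (a *: x) l = a *: x l. Proof. by []. Qed.

Definition hinner x y : R := \sum_(l < L) inner (x l) (y l).

Let hinner_zmodl y : zmod_morphism (hinner ^~ y).
Proof.
move=> x z; rewrite -sumrB; apply: eq_bigr => l _.
by rewrite hsumDE hsumNE linearBl.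
Qed.

Let hinner_zmodr x : zmod_morphism (hinner x).
Proof.
move=> y z; rewrite -sumrB; apply: eq_bigr => l _.
by rewrite hsumDE hsumNE linearBr.
Qed.

Let hinner_scalel y : scalable_for *%R (hinner ^~ y).
Proof.
move=> a x; rewrite /hinner /= mulr_sumr; apply: eq_bigr => l _.
by rewrite hsumZE linearZl.
Qed.

Let hinner_scaler x : scalable_for (@idfun R \; *%R) (hinner x).
Proof.
move=> a y; rewrite /hinner /= mulr_sumr; apply: eq_bigr => l _.
by rewrite hsumZE linearZr.
Qed.

HB.instance Definition _ := isBilinear.Build R (hsum H) (hsum H) R
  *%R (@idfun R \; *%R) hinner
  hinner_zmodl hinner_zmodr hinner_scalel hinner_scaler.

Let hinner_sym x y : hinner x y = (-1) ^+ false * @idfun R (hinner y x).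
Proof.
by rewrite expr0 mul1r; apply: eq_bigr => l _; rewrite hermC expr0 mul1r.
Qed.

HB.instance Definition _ := isHermitianSesquilinear.Build R (hsum H)
  false (@idfun R) hinner hinner_sym.

Let hinnerC x y : hinner x y = hinner y x.
Proof. by rewrite hinner_sym expr0 mul1r. Qed.

Let hinner_ge0 x : 0 <= hinner x x.
Proof. by apply: sumr_ge0 => l _; rewrite -sqr_normE sqr_ge0. Qed.

Let hinner_eq0 x : hinner x x = 0 -> x = 0.
Proof.
move=> /psumr_eq0P xx0; apply: functional_extensionality_dep => l.
apply/eqP; rewrite -normr_eq0 -sqrf_eq0 sqr_normE xx0// => i _.
by rewrite -sqr_normE sqr_ge0.
Qed.

Let hinner_gt0 x : x != 0 -> 0 < hinner x x.
Proof.
by move=> x0; rewrite lt_def hinner_ge0 andbT; apply: contra x0 => /eqP/hinner_eq0 ->.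
Qed.

HB.instance Definition _ := isDotProduct.Build R (hsum H) hinner hinner_gt0.

Let hnorm x : R := Num.sqrt (\sum_(l < L) `|x l| ^+ 2).

Let hnormE x : hnorm x = Num.sqrt (hinner x x).
Proof. by congr Num.sqrt; apply: eq_bigr => l _; rewrite sqr_normE. Qed.

Let sqr_hnorm x : hnorm x ^+ 2 = hinner x x.
Proof. by rewrite hnormE sqr_sqrtr. Qed.

Let hnorm_eq0 x : hnorm x = 0 -> x = 0.
Proof. by move=> x0; apply: hinner_eq0; rewrite -sqr_hnorm x0 expr0n. Qed.

Let hnormZ (a : R) x : hnorm (a *: x) = `|a| * hnorm x.
Proof.
rewrite !hnormE hinner_scalel hinner_scaler /= mulrA -expr2.
by rewrite sqrtrM ?sqr_ge0// sqrtr_sqr.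
Qed.

Let hinner_le x y : hinner x y <= hnorm x * hnorm y.
Proof.
have [->|y0] := eqVneq y 0.
  have -> : hinner x 0 = 0 by rewrite /hinner big1// => l _; rewrite linear0r.
  by rewrite mulr_ge0 ?sqrtr_ge0.
have B0 := hinner_gt0 y0.
rewrite (le_trans (ler_norm _))// -ler_sqr ?nnegrE ?mulr_ge0 ?sqrtr_ge0//.
rewrite real_normK ?num_real// exprMn !sqr_hnorm.
have := hinner_ge0 (hinner y y *: x - hinner x y *: y).
rewrite hinner_zmodl !hinner_zmodr !hinner_scalel !hinner_scaler /= (hinnerC y x).
set A := hinner x x; set B := hinner y y; set P := hinner x y => h.
rewrite -subr_ge0 -(pmulr_rge0 _ B0); apply: le_trans h _.
by rewrite -/B le_eqVlt; apply/orP; left; apply/eqP; ring.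
Qed.

Let ler_hnormD x y : hnorm (x + y) <= hnorm x + hnorm y.
Proof.
rewrite -ler_sqr ?nnegrE ?addr_ge0 ?sqrtr_ge0// sqrrD !sqr_hnorm.
have -> : hinner (x + y) (x + y)
    = hinner x x + hinner x y *+ 2 + hinner y y.
  rewrite -[X in hinner (_ + X)]opprK.
  rewrite /hinner -sumrMnl -!big_split /=; apply: eq_bigr => l _.
  have yx : inner (y l) (x l) = inner (x l) (y l).
    by rewrite hermC expr0 mul1r.
  rewrite opprK !hsumDE linearDl !linearDr /= yx.
  by rewrite mulr2n !addrA.
by rewrite lerD2r lerD2l lerMn2r hinner_le.
Qed.

HB.instance Definition _ :=
  Lmodule_isNormed.Build R (hsum H) ler_hnormD hnormZ hnorm_eq0.

Lemma hsum_normE x : `|x| = Num.sqrt (\sum_(l < L) `|x l| ^+ 2).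
Proof. by []. Qed.

HB.instance Definition _ := hasInner.Build R (hsum H) sqr_hnorm.

End hsum.

Section subdifferential.
Context {R : realType} {V : innerType R}.
Implicit Types (F : V -> \bar R) (x : V).

(* 0 by default when no gradient exists *)
Definition grad (f : V -> R) x : V :=
  xget 0 [set g : V | forall v : V, 'd f x v = inner g v].

Definition dom F : set V := [set x | (F x < +oo)%E].

Definition frechet_subdiff F x : set V := [set t | F x \is a fin_num /\
  (0 <= limf_einf (fun y => (F y - F x - (inner t (y - x))%:E)
                            * (`|y - x|^-1)%:E) x^')%E].

Definition limiting_subdiff F x : set V := [set t | F x \is a fin_num /\
  exists u s : nat -> V,
    [/\ u @ \oo --> x, F (u n) @[n --> \oo] --> F x,
        s @ \oo --> t & forall n, frechet_subdiff F (u n) (s n)]].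

(* dist(0, A), equal to +oo when A is empty *)
Definition dist0 (A : set V) : \bar R := ereal_inf [set `|t|%:E | t in A].

Record desingularizing (r : \bar R) (h : R -> R) : Prop := {
  desing_ge0 : forall t : R, 0 <= t -> (t%:E < r)%E -> 0 <= h t;
  desing_concave : forall s t a : R, 0 <= s -> (s%:E < r)%E ->
    0 <= t -> (t%:E < r)%E -> 0 <= a <= 1 ->
    a * h s + (1 - a) * h t <= h (a * s + (1 - a) * t);
  desing_continuous : {within [set t | 0 <= t /\ (t%:E < r)%E], continuous h};
  desing_at0 : h 0 = 0;
  desing_C1 : forall t : R, 0 < t -> (t%:E < r)%E ->
    [/\ derivable h t 1, {for t, continuous (derive1 h)} & 0 < derive1 h t]
}.

Definition KL_property F x := exists (r : \bar R) (U : set V) (h : R -> R),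
  [/\ (0 < r)%E, nbhs x U, desingularizing r h &
      forall u, U u -> (F x < F u)%E -> (F u < F x + r)%E ->
        (1 <= (derive1 h (fine (F u - F x)))%:E
              * dist0 (limiting_subdiff F u))%E].

Record regular_block_penalty F : Prop := {
  penalty_ge0 : forall x, (0 <= F x)%E;
  penalty_convex : forall x y (a : R), 0 < a < 1 ->
    (F (a *: x + (1 - a) *: y)%R <= a%:E * F x + (1 - a)%:E * F y)%E;
  penalty_proper : dom F !=set0;
  penalty_lsc : lower_semicontinuous F;
  penalty_lipschitz : [lipschitz (fine (F x)) | x in dom F]
}.

End subdifferential.

Section concave_outer.
Context {R : realType}.
Implicit Types h : \bar R -> \bar R.

(* difference quotient of h at t within the half-line [0, +oo[; its limit is
   the one-sided derivative at 0 *)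
Definition slope_at h (t s : R) : R :=
  (fine (h s%:E) - fine (h t%:E)) / (s - t).

Definition deriv_halfline h (t : R) : R :=
  lim (slope_at h t @ within [set s | 0 <= s] t^').

(* h is only meaningful on [0, +oo] *)
Record regular_concave h : Prop := {
  outer_gtNy : forall t, (0 <= t)%E -> (-oo < h t)%E;
  outer_concave : forall s t (a : R), (0 <= s)%E -> (0 <= t)%E -> 0 < a < 1 ->
    (a%:E * h s + (1 - a)%:E * h t <= h (a%:E * s + (1 - a)%:E * t))%E;
  outer_increasing : forall s t, (0 <= s)%E -> (s < t)%E -> (h s < h t)%E;
  outer_derivable : forall t : R, 0 <= t ->
    cvg (slope_at h t @ within [set s | 0 <= s] t^');
  outer_deriv_lipschitz :
    [locally [lipschitz (deriv_halfline h t) | t in [set t : R | 0 <= t]]]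
}.

End concave_outer.

Section composite.
Context {R : realType} {L : nat} {H : 'I_L -> euclideanType R}.
Implicit Types (f : hsum H -> R) (psi : forall l, H l -> \bar R).
Implicit Types (phi : 'I_L -> \bar R -> \bar R) (J : {set 'I_L}).
Implicit Types (x y z : hsum H).

(* x with its block l replaced by v *)
Definition set_block x l (v : H l) : hsum H := dfwith x l v.

(* (0, ..., 0, v, 0, ..., 0) *)
Definition inj_block l (v : H l) : hsum H := set_block 0 v.

(* f(x | y): the blocks in J are those of x, the other ones those of y *)
Definition mix J x y : hsum H := fun l => if l \in J then x l else y l.

Definition block_grad f l x : H l :=
  grad (fun v : H l => f (set_block x v)) (x l).

Record regular_smooth f : Prop := {
  smooth_diff : forall x, differentiable f x;
  smooth_grad : continuous (grad f);
  smooth_lipschitz : exists beta : 'I_L -> 'I_L -> R,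
    forall l j, 0 < beta l j /\ forall x (v : H j),
      `|block_grad f l (x + inj_block v) - block_grad f l x| <= beta l j * `|v|
}.

Definition quadratic_majorization f := exists nu_lo nu_up : R,
  [/\ 0 < nu_lo, 0 < nu_up & forall y J, exists A : forall l, 'End(H l),
    (forall l, l \in J ->
      (forall u v : H l, inner (A l u) v = inner u (A l v)) /\
      (forall u : H l, nu_lo * `|u| ^+ 2 <= inner u (A l u)
                       <= nu_up * `|u| ^+ 2)) /\
    forall x, f (mix J x y) <= f y + \sum_(l in J)
      (inner (x l - y l) (block_grad f l y)
       + 2^-1 * inner (x l - y l) (A l (x l - y l)))].

Definition objective f psi phi x : \bar R :=
  ((f x)%:E + \sum_(l < L) phi l (psi l (x l)))%E.

(* The majorant of the objective at y *)
Definition majorant f psi phi y x : \bar R :=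
  ((f x)%:E + \sum_(l < L) (phi l (psi l (y l)) +
     (deriv_halfline (phi l) (fine (psi l (y l))))%:E
       * (psi l (x l) - psi l (y l))))%E.

(* F is mu-strongly convex in the blocks of J, the other ones being fixed
   where psi is finite *)
Definition strongly_convex_wrt psi J (mu : R) (F : hsum H -> \bar R) :=
  forall x y (a : R),
    (forall l, l \notin J -> x l = y l /\ (psi l (x l) < +oo)%E) ->
    0 < a < 1 ->
    (F (a *: x + (1 - a) *: y)%R <= a%:E * F x + (1 - a)%:E * F y
      - (mu / 2 * (a * (1 - a)) * `|x - y| ^+ 2)%:E)%E.

(* z is a minimizer of F with respect to the blocks in J, the other ones being
   fixed to those of y *)
Definition block_minimizer J (F : hsum H -> \bar R) y z :=
  (forall l, l \notin J -> z l = y l) /\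
  forall w, (forall l, l \notin J -> w l = y l) -> (F z <= F w)%E.

(* x k are the outer iterates, xt k i with i <= I k the inner ones *)
Record CO_GS f psi phi (I : nat -> nat) (J : nat -> nat -> {set 'I_L})
    (x : nat -> hsum H) (xt : nat -> nat -> hsum H) : Prop := {
  GS_dom : dom (objective f psi phi) (x 0%N);
  GS_dom_block : forall l, dom (psi l) (x 0%N l);
  GS_start : forall k, xt k 0%N = x k;
  GS_step : forall k i, (i < I k)%N ->
    block_minimizer (J k i) (majorant f psi phi (x k)) (xt k i) (xt k i.+1) /\
    dom (objective f psi phi) (xt k i.+1);
  GS_end : forall k, x k.+1 = xt k (I k)
}.

End composite.

(* Main.v *)
(* Minimality of each inner step together with strong convexity, and concavity
   of the [phi l] (the majorant touches the objective at [x k] and dominates it),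
   give the sufficient decrease  c * S_k ^ 2 <= Psi (x k) - Psi (x (k + 1)),
   where S_k is the total length of the inner path from [x k] to [x (k + 1)].
   The optimality condition of the last inner step updating block [l] yields a
   convex subgradient of [psi l] at [x (k + 1)]; the chain rule turns it into a
   Fréchet subgradient of Psi at [x (k + 1)], which is O(S_k) near a cluster
   point since the block gradients, [psi l] and the derivative of [phi l] are
   locally Lipschitz. With the Kurdyka-Łojasiewicz inequality at a cluster point
   this gives  2 * S_(k+1) <= S_k + D * (h_(k+1) - h_(k+2)), h_k being the
   desingularized gap at [x k]: the S_k are summable, so the iterates converge
   and the subgradients tend to 0. *)

Require Import Defs.
From HB Require Import structures.
From mathcomp Require Import all_boot all_order all_algebra.
From mathcomp Require Import all_classical all_reals all_analysis.
From mathcomp Require Import ring lra.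

Set Implicit Arguments.
Unset Strict Implicit.
Unset Printing Implicit Defensive.

Import Order.TTheory GRing.Theory Num.Theory.
Import numFieldNormedType.Exports.

Local Open Scope classical_set_scope.
Local Open Scope ring_scope.

(** * Ultrafilters, inner products and compactness in Euclidean spaces *)

Lemma fmap_ultra (T U : Type) (f : T -> U) (F : set_system T) :
  UltraFilter F -> UltraFilter (f @ F).
Proof.
move=> FU; split=> [|G GF FG]; first exact: fmap_proper_filter.
rewrite predeqE => A; split=> [GA|]; last exact: FG.
have [//|FnA] := in_ultra_setVsetC (f @^-1` A) FU.
have GnA : G (~` A) by apply: FG.
by have [x []] := @filter_ex _ _ GF _ (@filterI _ _ (@filter_filter _ _ GF) _ _ GA GnA).
Qed.

Section inner_space.
Context {R : realType} {V : innerType R}.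
Implicit Types u v : V.

Lemma innerC u v : inner u v = inner v u.
Proof. by rewrite hermC expr0 mul1r. Qed.

(** Cauchy-Schwarz: the square of the norm of [|v| u - |u| v] equals
    [2 |u| |v| (|u| |v| - inner u v)]. *)
Lemma inner_le u v : inner u v <= `|u| * `|v|.
Proof.
have [->|v0] := eqVneq v 0; first by rewrite linear0r normr0 mulr0.
have [->|u0] := eqVneq u 0; first by rewrite linear0l normr0 mul0r.
have : 0 <= `| `|v| *: u - `|u| *: v| ^+ 2 by rewrite sqr_ge0.
rewrite sqr_normE linearBl !linearBr !linearZl !linearZr /= -!sqr_normE (innerC v u).
have := normr_gt0 u; rewrite u0; have := normr_gt0 v; rewrite v0.
set a := `|u|; set b := `|v|; set c := inner u v => b0 a0.
rewrite (_ : _ - _ = 2 * (a * b) * (a * b - c)); last by ring.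
by rewrite pmulr_rge0 ?subr_ge0// !mulr_gt0.
Qed.

Lemma normr_inner_le u v : `|inner u v| <= `|u| * `|v|.
Proof.
rewrite ler_norml inner_le andbT lerNl -(mulN1r (inner _ _)).
by have := inner_le (- u) v; rewrite linearNl normrN mulN1r.
Qed.

End inner_space.

Section euclidean.
Context {R : realType} {V : euclideanType R}.

Let e := vbasis {:V}.

(** The map [T] from [u] to its inner products with the basis vectors is injective, hence surjective
    by dimension count; [u] is a preimage of the values of [g] on the basis. *)
Lemma riesz_representation (g : {linear V -> R^o}) :
  exists u : V, forall v, g v = inner u v.
Proof.
pose T0 (u : V) : 'rV[R]_(\dim {:V}) := \row_i inner u e`_i.
have T0l : linear T0.
  by move=> a u v; apply/rowP => i; rewrite !mxE linearDl linearZl.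
pose T : {linear V -> 'rV[R]_(\dim {:V})} :=
  HB.pack T0 (GRing.isLinear.Build _ _ _ _ _ T0l).
have expand (v : V) : v = \sum_i coord e i v *: e`_i.
  by rewrite -coord_vbasis ?memvf.
have Tinj : lker (linfun T) == 0%VS.
  apply/lker0P => u v; rewrite !lfunE /= => /rowP uv.
  apply/eqP; rewrite -subr_eq0 -normr_eq0 -sqrf_eq0 sqr_normE.
  rewrite [X in inner _ X]expand linear_sumr big1// => i _.
  rewrite linearZr /= linearBl; have := uv i; rewrite !mxE => uvi.
  by apply/eqP; rewrite mulf_eq0 subr_eq0; apply/orP; right; apply/eqP; exact: uvi.
have Tsurj : limg (linfun T) = fullv.
  apply/eqP; rewrite eqEdim subvf /= limg_dim_eq ?(eqP Tinj) ?capv0//.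
  by rewrite [X in (X <= _)%N]dimvf dim_matrix mul1r.

have /memv_imgP[u _ uE] : \row_i g e`_i \in limg (linfun T) by rewrite Tsurj memvf.
exists u => v; rewrite [in LHS](expand v) [in RHS](expand v) linear_sum linear_sumr.
apply: eq_bigr => i _; rewrite linearZ linearZr /=; congr *%R.
by move/rowP: uE => /(_ i); rewrite lfunE !mxE.
Qed.

(** Each coordinate is a linear form, so by Riesz and Cauchy-Schwarz it stays in a compact segment,
    where the image ultrafilter converges. This replaces the extraction of subsequences. *)
Lemma bounded_ultra_cvg (G : set_system nat) (u : nat -> V) (M : R) :
  UltraFilter G -> (forall n, `|u n| <= M) -> exists p : V, u n @[n --> G] --> p.
Proof.
move=> GU uM.
have expand (v : V) : v = \sum_i coord e i v *: e`_i.
  by rewrite -coord_vbasis ?memvf.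
have cvgc i : exists p : R, coord e i (u n) @[n --> G] --> p.
  have [g gE] := riesz_representation (coord e i).
  have FU : UltraFilter (coord e i (u n) @[n --> G]) by exact: fmap_ultra.
  have := @segment_compact R (- (`|g| * M)) (`|g| * M); rewrite compact_ultra.
  move=> /(_ _ FU) []; last by move=> p [_ pP]; exists p.
  apply: (@filterE _ G) => n /=.
  by rewrite in_itv /= -ler_norml gE (le_trans (normr_inner_le _ _))// ler_wpM2l.
have [p pP] := choice cvgc.
exists (\sum_i p i *: e`_i).
under eq_fun => n do rewrite (expand (u n)).
apply: cvg_big => [|i _]; first exact: add_continuous.
by apply: cvgZr_tmp; exact: pP.
Qed.

End euclidean.

(** * Block gradients *)

Section hsum_blocks.
Context {R : realType} {L : nat} {H : 'I_L -> euclideanType R}.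
Implicit Types (x y : hsum H) (l : 'I_L).

Lemma inj_block_id l (v : H l) : inj_block v l = v.
Proof. by rewrite /inj_block /set_block dfwithin. Qed.

Lemma inj_block_ne l (v : H l) j : j != l -> inj_block v j = 0.
Proof. by move=> jl; rewrite /inj_block /set_block dfwithout// eq_sym. Qed.

Lemma hsum_ext x y : (forall l, x l = y l) -> x = y.
Proof. by move=> xy; apply: functional_extensionality_dep. Qed.

Lemma inj_block_linear l : linear (@inj_block R L H l).
Proof.
move=> a u v; apply: hsum_ext => j; rewrite hsumDE hsumZE.
have [->|jl] := eqVneq j l; first by rewrite !inj_block_id.
by rewrite !inj_block_ne// scaler0 addr0.
Qed.

HB.instance Definition _ l :=
  GRing.isLinear.Build R (H l) (hsum H) _ _ (@inj_block_linear l).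

Lemma hsum_sumE (T : Type) (r : seq T) (P : pred T) (F : T -> hsum H) l :
  (\sum_(i <- r | P i) F i) l = \sum_(i <- r | P i) F i l.
Proof. by elim/big_rec2: _ => // i u v _ <-. Qed.

Lemma hsum_decomp x : x = \sum_l inj_block (x l).
Proof.
apply: hsum_ext => j; rewrite hsum_sumE (bigD1 j)//= inj_block_id big1 ?addr0//.
by move=> i ij; rewrite inj_block_ne// eq_sym.
Qed.

Lemma normr_inj_block l (v : H l) : `|inj_block v| = `|v|.
Proof.
rewrite hsum_normE (bigD1 l)//= inj_block_id big1 ?addr0 ?sqrtr_sqr ?normr_id//.
by move=> j jl; rewrite inj_block_ne// normr0 expr0n.
Qed.

Lemma normr_block_le x l : `|x l| <= `|x|.
Proof.
rewrite hsum_normE -[leLHS]normr_id -sqrtr_sqr ler_wsqrtr// (bigD1 l)//= lerDl.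
by apply: sumr_ge0 => i _; rewrite sqr_ge0.
Qed.

Lemma normr_hsum_le x : `|x| <= \sum_l `|x l|.
Proof.
rewrite [in leLHS](hsum_decomp x) (le_trans (ler_norm_sum _ _ _))//.
by apply: ler_sum => l _; rewrite normr_inj_block.
Qed.

Lemma inner_hsumE x y : inner x y = \sum_l inner (x l) (y l).
Proof. by []. Qed.

Lemma inj_block_continuous l : continuous (@inj_block R L H l).
Proof.
apply: bounded_linear_continuous; apply/linear_boundedP.
by near=> r => v; rewrite normr_inj_block ler_peMl.
Unshelve. all: by end_near. Qed.

Lemma set_blockE x l (v : H l) : set_block x v = x + inj_block (v - x l).
Proof.
apply: hsum_ext => j; rewrite hsumDE.
have [->|jl] := eqVneq j l.
  by rewrite inj_block_id addrC subrK /set_block dfwithin.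
by rewrite inj_block_ne// addr0 /set_block dfwithout// eq_sym.
Qed.

Lemma hsum_bounded_ultra_cvg (G : set_system nat) (u : nat -> hsum H) (M : R) :
  UltraFilter G -> (forall n, `|u n| <= M) ->
  exists p : hsum H, u n @[n --> G] --> p.
Proof.
move=> GU uM.
have cvgb l : exists p : H l, u n l @[n --> G] --> p.
  apply: (@bounded_ultra_cvg _ _ _ _ M) => n.
  by rewrite (le_trans (normr_block_le _ _)).
pose p : hsum H := fun l => projT1 (cid (cvgb l)).
exists p; rewrite [in X in _ --> X](hsum_decomp p).
under eq_fun => n do rewrite (hsum_decomp (u n)).
apply: cvg_big => [|l _]; first exact: add_continuous.
apply: continuous_cvg; first exact: inj_block_continuous.
exact: projT2 (cid (cvgb l)).
Qed.

Section gradient.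
Variable f : hsum H -> R.

(** The block function is [f] after an affine injection, so its differential is ['d f x] after
    [inj_block]. Riesz then ensures that the choice made in [grad] is a true gradient, not the
    default 0. *)
Lemma diff_inj_block x l (v : H l) : differentiable f x ->
  'd f x (inj_block v) = inner (block_grad f l x) v.
Proof.
move=> df.
pose g (w : H l) := f (set_block x w).
pose dg : {linear H l -> R} := 'd f x \o @inj_block R L H l.
have dgE : 'd g (x l) = dg :> (H l -> R).
  apply: diff_unique.
    move=> w; apply: continuous_comp; first exact: inj_block_continuous.
    exact: diff_continuous.
  apply/eqaddoP => e e0.
  have /diff_locally/eqaddoP/(_ e e0) := df.
  have c0 : @inj_block R L H l w @[w --> 0] --> (0 : hsum H).
    by have := @inj_block_continuous l 0; rewrite /continuous_at linear0.
  move=> /c0 c1; apply: (@filterS _ (nbhs (0 : H l)) _ _ _ _ c1) => w.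
  rewrite !fctE /= normr_inj_block /g /shift /= !set_blockE addrK subrr linear0.
  by rewrite addr0 [x + _]addrC.
have : exists u : H l, forall w, 'd g (x l) w = inner u w.
  exact: riesz_representation.
move=> /(xgetPex 0) /= /(_ v) E.
by rewrite /block_grad /grad -E (dgE : _ = _).
Qed.

Definition blocks_grad x : hsum H := fun l => block_grad f l x.

Lemma diff_blocks_grad x y : differentiable f x ->
  'd f x y = inner (blocks_grad x) y.
Proof.
move=> df; rewrite [in LHS](hsum_decomp y) linear_sum inner_hsumE.
by apply: eq_bigr => l _; rewrite diff_inj_block.
Qed.

Lemma gradient_expansion x (e : R) : differentiable f x -> 0 < e ->
  \forall y \near x,
    `|f y - f x - inner (blocks_grad x) (y - x)| <= e * `|y - x|.
Proof.
move=> df e0; have [[_ /eqaddoP /(_ e e0) h]] := df.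
apply: (@filterS _ (nbhs x) _ _ _ _ h) => y.
rewrite !fctE /= lim_id// diff_blocks_grad//.
by rewrite opprD addrA.
Qed.

End gradient.

Section gradient_lipschitz.
Variables (f : hsum H -> R) (l : 'I_L) (beta : 'I_L -> R).
Hypothesis beta_ge0 : forall j, 0 <= beta j.
Hypothesis fl : forall j x (v : H j),
  `|block_grad f l (x + inj_block v) - block_grad f l x| <= beta j * `|v|.

(** Going from [y] to [x] one block at a time, each move costs one partial Lipschitz bound. *)
Lemma block_grad_lipschitz x y :
  `|block_grad f l x - block_grad f l y| <= (\sum_j beta j) * `|x - y|.
Proof.
have step (s : seq 'I_L) (z : hsum H) :
    `|block_grad f l (y + \sum_(j <- s) inj_block (z j)) - block_grad f l y|
    <= \sum_(j <- s) beta j * `|z j|.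
  elim: s => [|j s IHs]; first by rewrite !big_nil addr0 subrr normr0.
  rewrite !big_cons [X in y + X]addrC addrA.
  rewrite (le_trans (ler_distD (block_grad f l (y + \sum_(j <- s) inj_block (z j))) _ _))//.
  by rewrite lerD// fl.
have := step (index_enum 'I_L) (x - y); rewrite -hsum_decomp addrCA subrr addr0.
move=> /le_trans; apply; rewrite mulr_suml; apply: ler_sum => j _.
by rewrite ler_wpM2l// normr_block_le.
Qed.

End gradient_lipschitz.
End hsum_blocks.

(** * Concave functions on the half-line *)

Section concave_halfline.
Context {R : realType} (h : \bar R -> \bar R).
Hypothesis hh : regular_concave h.

Let r (t : R) : R := fine (h t%:E).
Let d := deriv_halfline h.

(** Strict increase excludes the value [+oo] at a finite argument, since [h t] lies below
    [h (t + 1)]. *)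
Lemma outer_fin (t : R) : 0 <= t -> h t%:E = (r t)%:E.
Proof.
move=> t0; rewrite /r fineK// fin_numElt (outer_gtNy hh) ?lee_fin//=.
have : (h t%:E < h (t + 1)%:E)%E by apply: (outer_increasing hh); rewrite ?lee_fin ?lte_fin ?ltrDl.
by move=> /lt_le_trans; apply; rewrite leey.
Qed.

Lemma outer_concave_real (s t a : R) : 0 <= s -> 0 <= t -> 0 < a < 1 ->
  a * r s + (1 - a) * r t <= r (a * s + (1 - a) * t).
Proof.
move=> s0 t0 a01; have /andP[a0 a1] := a01.
have := outer_concave hh (s := s%:E) (t := t%:E) s0 t0 a01.
have u0 : 0 <= a * s + (1 - a) * t by rewrite addr_ge0// mulr_ge0// ?subr_ge0 ltW.
by rewrite -!EFinM -EFinD !outer_fin// -!EFinM -EFinD lee_fin.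
Qed.

Lemma outer_lt (s t : R) : 0 <= s -> s < t -> r s < r t.
Proof.
move=> s0 st; have := outer_increasing hh (s := s%:E) (t := t%:E) s0.
by rewrite lte_fin => /(_ st); rewrite !outer_fin ?lte_fin// (le_trans s0)// ltW.
Qed.

Lemma outer_expansion (t e : R) : 0 <= t -> 0 < e ->
  \forall s \near t, 0 <= s -> `|r s - r t - d t * (s - t)| <= e * `|s - t|.
Proof.
move=> t0 e0; have /cvgrPdist_le/(_ _ e0) := outer_derivable hh t0.
rewrite -/(deriv_halfline h t) -/d.
move=> C0; have C : \forall s \near t, s != t -> 0 <= s ->
    `|d t - slope_at h t s| <= e by exact: C0.
apply: filterS C => s C s0; have [->|st] := eqVneq s t.
  by rewrite !subrr mulr0 subrr normr0 mulr0.
have : `|slope_at h t s - d t| <= e by rewrite distrC; exact: C.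
rewrite -(@ler_pM2r _ `|s - t|) ?normr_gt0 ?subr_eq0// -normrM mulrBl.
by rewrite /slope_at divfK ?subr_eq0.
Qed.

(** Concavity at [u = t + a (s - t)] gives [a (r s - r t) <= r u - r t]; the expansion at [t] bounds
    the right side by [a (d t (s - t) + e)], and [a] cancels. *)
Lemma outer_tangent (s t : R) : 0 <= s -> 0 <= t -> r s <= r t + d t * (s - t).
Proof.
move=> s0 t0; apply/ler_addgt0Pl => e e0.
have [->|st] := eqVneq s t; first by rewrite subrr mulr0 addr0 lerDr ltW.
have nst : 0 < `|s - t| by rewrite normr_gt0 subr_eq0.
have e'0 : 0 < e / `|s - t| by rewrite divr_gt0.
have /nbhs_ballP[eta /= eta0 E] := outer_expansion t0 e'0.
(* The first bound keeps [a] below 1, the second puts [u] in the ball where the expansion holds. *)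
pose a := Num.min (2^-1) (eta / 2 / `|s - t|).
have a0 : 0 < a by rewrite lt_min invr_gt0 ltr0n/= !divr_gt0.
have a1 : a < 1 by rewrite gt_min invf_lt1 ?ltr0n// ltr1n.
pose u := a * s + (1 - a) * t.
have uE : u - t = a * (s - t) by rewrite /u; ring.
have u0 : 0 <= u by rewrite /u addr_ge0// mulr_ge0// ?subr_ge0 ltW.
have ut : `|u - t| = a * `|s - t| by rewrite uE normrM gtr0_norm.
have /E/(_ u0) : ball t eta u.
  rewrite /ball/= distrC ut.
  rewrite (@le_lt_trans _ _ (eta / 2))//; last by rewrite ltr_pdivrMr// ltr_pMr// ltr1n.
  by rewrite -ler_pdivlMr// ge_min lexx orbT.
have := @outer_concave_real s t a s0 t0; rewrite a0 a1 -/u => /(_ isT) c.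
rewrite ut mulrCA divfK ?gt_eqF// => /ler_normlP[_].
rewrite uE => k.
rewrite -(ler_pM2l a0); move: c k; nra.
Qed.

(** By the tangent inequality [d t] is at least the increase of [r] from [t] to [t + 1]. *)
Lemma outer_deriv_gt0 (t : R) : 0 <= t -> 0 < d t.
Proof.
move=> t0; have t1 : t < t + 1 by rewrite ltrDl.
have := outer_lt t0 t1; have := @outer_tangent (t + 1) t; lra.
Qed.

(** Sum of the tangent inequalities at [s] and at [t]. *)
Lemma outer_deriv_antitone (s t : R) : 0 <= s -> s <= t -> d t <= d s.
Proof.
move=> s0; rewrite le_eqVlt => /predU1P[->//|st].
have t0 : 0 <= t by rewrite (le_trans s0)// ltW.
have := @outer_tangent s t s0 t0; have := @outer_tangent t s t0 s0.
move=> h1 h2; have : (d s - d t) * (t - s) >= 0 by nra.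
by rewrite pmulr_lge0 ?subr_gt0// subr_ge0.
Qed.

Lemma outer_deriv_locally_lipschitz (t : R) : 0 <= t -> exists2 K : R, 0 < K &
  exists2 e : R, 0 < e & forall s s', 0 <= s -> 0 <= s' ->
    `|s - t| < e -> `|s' - t| < e -> `|d s - d s'| <= K * `|s - s'|.
Proof.
move=> t0; have := outer_deriv_lipschitz hh (x := (t, t)) (conj t0 t0).
move=> /pinfty_ex_gt0[K K0] /nbhs_ballP[e /= e0 E].
exists K => //; exists e => // s s' s0 s'0 se s'e.
by apply: (E (s, s')) => //; split; rewrite /ball/= distrC.
Qed.

End concave_halfline.

(** * Fréchet subgradients and block penalties *)

Section frechet.
Context {R : realType} {V : innerType R}.

(** For each [e], the inequality holds on a punctured neighbourhood, where the quotient is then at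
    least [-e]; hence so is its lower limit. *)
Lemma frechet_subdiff_intro (F : V -> \bar R) (x t : V) :
  F x \is a fin_num ->
  (forall e : R, 0 < e -> \forall y \near x,
    (F x + (inner t (y - x) - e * `|y - x|)%:E <= F y)%E) ->
  frechet_subdiff F x t.
Proof.
move=> Fx FE; split=> //; rewrite limf_einfE; apply/lee_addgt0Pr => e e0.
rewrite -leeBlDr// sub0e; apply: le_ereal_sup_tmp.
pose A := [set y : V | y != x /\
  (F x + (inner t (y - x) - e * `|y - x|)%:E <= F y)%E].
have Ax : x^' A by apply: filterS (FE e e0) => y ? ?; split.
eexists; first by exists A.
apply: le_ereal_inf_tmp => _ [y [yx yF] <-].
have nyx : 0 < `|y - x| by rewrite normr_gt0 subr_eq0.
rewrite lee_pdivlMr//.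
move: yF Fx; case: (F x) => // a; case: (F y) => [b| |] //.
- rewrite -!EFinB -!EFinD -EFinM !lee_fin; lra.
- by rewrite !addye// ?leey.
Qed.

Lemma limiting_subdiff_frechet (F : V -> \bar R) (x : V) :
  frechet_subdiff F x `<=` limiting_subdiff F x.
Proof.
move=> t tx; split; first by case: tx.
by exists (fun=> x), (fun=> t); split=> //; exact: cvg_cst.
Qed.

Lemma dist0_le (A : set V) (t : V) : A t -> (dist0 A <= `|t|%:E)%E.
Proof. by move=> At; apply: ereal_inf_lbound; exists t. Qed.

End frechet.

Definition convex_subgradient {R : realType} {V : innerType R}
    (F : V -> \bar R) (x s : V) :=
  forall v, (F x + (inner s (v - x))%:E <= F v)%E.

Section block_penalty.
Context {R : realType} {V : innerType R} (F : V -> \bar R).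
Hypothesis HF : regular_block_penalty F.
Let p v := fine (F v).

Lemma penalty_EFin v : (F v < +oo)%E -> F v = (p v)%:E.
Proof.
by move=> Fv; rewrite /p fineK// ge0_fin_numE// (penalty_ge0 HF).
Qed.

Lemma penalty_fine_ge0 v : 0 <= p v.
Proof. exact/fine_ge0/(penalty_ge0 HF). Qed.

Lemma penalty_convex_dom u v (a : R) : 0 < a < 1 -> (F u < +oo)%E -> (F v < +oo)%E ->
  (F (a *: u + (1 - a) *: v)%R < +oo)%E /\
  p (a *: u + (1 - a) *: v) <= a * p u + (1 - a) * p v.
Proof.
move=> a01 Fu Fv; have := penalty_convex HF u v a01.
rewrite (penalty_EFin Fu) (penalty_EFin Fv) -!EFinM -EFinD => h.
have Fw : (F (a *: u + (1 - a) *: v)%R < +oo)%E by rewrite (le_lt_trans h)// ltry.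
by split=> //; rewrite (penalty_EFin Fw) lee_fin in h.
Qed.

Lemma penalty_lipschitz_dom : exists2 K : R, 0 < K &
  forall u v, (F u < +oo)%E -> (F v < +oo)%E -> `|p u - p v| <= K * `|u - v|.
Proof.
have /pinfty_ex_gt0[K K0 HK] := penalty_lipschitz HF.
by exists K => // u v Fu Fv; apply: (HK (u, v)).
Qed.

(* Truncating the affine minorant of [F] at [0] keeps the argument of [h]
   inside [0, +oo]. *)
Lemma outer_penalty_expansion (h : \bar R -> \bar R) (x s : V) (e : R) :
  regular_concave h -> (F x < +oo)%E -> convex_subgradient F x s -> 0 < e ->
  \forall v \near x,
    (h (F x) + (deriv_halfline h (p x) * inner s (v - x) - e * `|v - x|)%:E
     <= h (F v))%E.
Proof.
move=> hh Fx sx e0.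
(* Chosen so that [e' * |c|], with [|c| <= |s| * |v - x|], stays below [e * |v - x|]; the 1 covers
   [s = 0]. *)
pose e' := e / (`|s| + 1).
have s1 : 0 < `|s| + 1 by rewrite ltr_wpDl.
have e'0 : 0 < e' by rewrite divr_gt0.
have px0 := penalty_fine_ge0 x.
have /nbhs_ballP[eta /= eta0 E] := outer_expansion hh px0 e'0.
have eta'0 : 0 < eta / (`|s| + 1) by rewrite divr_gt0.
apply/nbhs_ballP; exists (eta / (`|s| + 1)) => //= v.
rewrite -ball_normE /= distrC ltr_pdivlMr// => vx.
set c := inner s (v - x).
have cle : `|c| <= `|s| * `|v - x| by exact: normr_inner_le.
pose tau := Num.max (p x + c) 0.
have tau0 : 0 <= tau by rewrite le_max lexx orbT.
have tauc : c <= tau - p x by rewrite lerBrDl le_max lexx.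
have tau_near : `|tau - p x| <= `|c|.
  rewrite /tau; case: (leP (p x + c) 0) => pc; last by rewrite addrAC subrr add0r.
  by rewrite sub0r normrN (ger0_norm px0) ler_normr; apply/orP; right; lra.
have hle : (h tau%:E <= h (F v))%E.
  have : (tau%:E <= F v)%E.
    rewrite /tau EFin_max ge_max (penalty_ge0 HF) andbT.
    by rewrite EFinD -(penalty_EFin Fx); exact: sx.
  rewrite le_eqVlt => /predU1P[->//|lt].
  by apply/ltW/(outer_increasing hh) => //; rewrite lee_fin.
apply: le_trans hle.
rewrite (penalty_EFin Fx) (outer_fin hh px0) (outer_fin hh tau0) -EFinD lee_fin.
have /E/(_ tau0) : ball (p x) eta tau.
  rewrite /ball/= distrC (le_lt_trans tau_near)// (le_lt_trans cle)//.
  rewrite (le_lt_trans _ vx)// mulrC ler_wpM2l// lerDl//.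
have d0 := outer_deriv_gt0 hh px0.
have e's : e' * `|tau - p x| <= e * `|v - x|.
  rewrite /e' mulrAC ler_pdivrMr// -mulrA ler_wpM2l ?(ltW e0)//.
  rewrite (le_trans tau_near)// (le_trans cle)// mulrC ler_wpM2l// lerDl//.
move=> /ler_normlP[h1 _].
have : deriv_halfline h (p x) * c <= deriv_halfline h (p x) * (tau - p x).
  by rewrite ler_pM2l.
lra.
Qed.

End block_penalty.

(** * The objective and its majorants *)

Section composite.
Context {R : realType} {L : nat} {H : 'I_L -> euclideanType R}.
Variables (f : hsum H -> R) (psi : forall l, H l -> \bar R)
  (phi : 'I_L -> \bar R -> \bar R).
Arguments psi : clear implicits.
Hypotheses (Hf : forall x, differentiable f x)
  (Hpsi : forall l, regular_block_penalty (psi l))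
  (Hphi : forall l, regular_concave (phi l)).
Implicit Types (x y z u : hsum H) (J : {set 'I_L}).

(** Membership in [dom (objective f psi phi)] does not imply this condition, as [phi l] may be
    finite at [+oo]. *)
Definition psi_dom : set (hsum H) := [set x | forall l, (psi l (x l) < +oo)%E].

Definition psi_fine x l : R := fine (psi l (x l)).

Definition weight x l : R := deriv_halfline (phi l) (psi_fine x l).

Definition objective_fine x : R :=
  f x + \sum_l fine (phi l (psi_fine x l)%:E).

Definition majorant_fine y x : R :=
  f x + \sum_l (fine (phi l (psi_fine y l)%:E) +
                weight y l * (psi_fine x l - psi_fine y l)).

Lemma psi_fineE x l : psi_dom x -> psi l (x l) = (psi_fine x l)%:E.
Proof. by move=> Dx; rewrite (penalty_EFin (Hpsi l) (Dx l)). Qed.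

Lemma psi_fine_ge0 x l : 0 <= psi_fine x l.
Proof. exact: penalty_fine_ge0. Qed.

Lemma weight_gt0 x l : 0 < weight x l.
Proof. exact/outer_deriv_gt0/psi_fine_ge0. Qed.

Lemma objectiveE x : psi_dom x -> objective f psi phi x = (objective_fine x)%:E.
Proof.
move=> Dx; rewrite /objective /objective_fine EFinD -sumEFin; congr (_ + _)%E.
by apply: eq_bigr => l _; rewrite psi_fineE// outer_fin// psi_fine_ge0.
Qed.

Lemma majorantE y x : psi_dom y -> psi_dom x ->
  majorant f psi phi y x = (majorant_fine y x)%:E.
Proof.
move=> Dy Dx; rewrite /majorant /majorant_fine EFinD -sumEFin; congr (_ + _)%E.
apply: eq_bigr => l _; rewrite !psi_fineE// (outer_fin (Hphi l) (psi_fine_ge0 y l)).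
by rewrite -EFinB -EFinM -EFinD.
Qed.

(** The weights are positive, so [psi l (x l) = +oo] makes its summand [+oo], while no summand is
    [-oo]. *)
Lemma majorant_dom y x : psi_dom y -> (majorant f psi phi y x < +oo)%E -> psi_dom x.
Proof.
move=> Dy; apply: contraPP => /existsNP[l /negP]; rewrite ltey negbK => /eqP xl.
have term i : (-oo < phi i (psi i (y i)) + (deriv_halfline (phi i)
    (fine (psi i (y i))))%:E * (psi i (x i) - psi i (y i)))%E.
  rewrite (psi_fineE i Dy) (outer_fin (Hphi i) (psi_fine_ge0 y i)).
  have := penalty_ge0 (Hpsi i) (x i); case: (psi i (x i)) => [r _|_|//].
    by rewrite -EFinB -EFinM -EFinD ltNyr.
  by rewrite addye// gt0_muley ?lte_fin ?weight_gt0// addey.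
apply/negP; rewrite -leNgt leye_eq /majorant.
set S := \sum_(l < L) _; have -> : S = +oo%E.
  apply/eqP; rewrite esum_eqy; last by move=> i _; rewrite gt_eqF.
  apply/existsP; exists l; rewrite xl (psi_fineE l Dy).
  rewrite (outer_fin (Hphi l) (psi_fine_ge0 y l)).
  by rewrite addye// gt0_muley ?lte_fin ?weight_gt0//= addey.
by rewrite addey.
Qed.

Lemma majorant_fine_diag y : majorant_fine y y = objective_fine y.
Proof.
by congr (_ + _); apply: eq_bigr => l _; rewrite subrr mulr0 addr0.
Qed.

(** The majorant replaces each [phi l] by its tangent at [psi_fine y l], which lies above it by
    concavity. *)
Lemma objective_le_majorant y x : objective_fine x <= majorant_fine y x.
Proof.
rewrite lerD2l; apply: ler_sum => l _.
exact: outer_tangent (psi_fine_ge0 _ _) (psi_fine_ge0 _ _).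
Qed.

Lemma block_minimizer_dom J y u z : psi_dom y -> psi_dom u ->
  block_minimizer J (majorant f psi phi y) u z -> psi_dom z.
Proof.
move=> Dy Du [zu zmin]; apply: (majorant_dom Dy).
by rewrite (le_lt_trans (zmin u _))// majorantE// ltry.
Qed.

(** The midpoint [w] of [u] and [z] is a competitor of [z], and strong convexity puts the majorant
    at [w] below the mean of its values at [u] and [z] by [mu / 8 * |z - u| ^ 2]. *)
Lemma majorant_descent J y u z (mu : R) : psi_dom y -> psi_dom u ->
  block_minimizer J (majorant f psi phi y) u z ->
  strongly_convex_wrt psi J mu (majorant f psi phi y) ->
  majorant_fine y z + mu / 4 * `|z - u| ^+ 2 <= majorant_fine y u.
Proof.
move=> Dy Du zmin sc; have Dz := block_minimizer_dom Dy Du zmin.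
have [zu zle] := zmin.
pose w : hsum H := 2^-1 *: u + (1 - 2^-1) *: z.
have half : 0 < (2^-1 : R) < 1 by rewrite invr_gt0 ltr0n invf_lt1// ltr1n.
have Dw : psi_dom w.
  by move=> l; have [] := penalty_convex_dom (Hpsi l) half (Du l) (Dz l).
have := sc u z 2^-1 (fun l lJ => conj (esym (zu l lJ)) (Du l)) half.
have := zle w; rewrite -/w !majorantE// -!EFinM -!EFinD !lee_fin.
move=> /(_ _) wz h.
have {}wz : majorant_fine y z <= majorant_fine y w.
  apply: wz => l lJ; rewrite /w hsumDE !hsumZE zu// -scalerDl.
  by rewrite addrC subrK scale1r.
rewrite distrC; lra.
Qed.

(** Fermat's rule: [z] is compared with points [za] moved by a fraction [a] towards [v] in block [l]
    alone. Convexity of [psi l] and the expansion of [f] at [z] give the inequality, up to [e],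
    after division by [a]. *)
Lemma block_optimality J y u z l : psi_dom y -> psi_dom u ->
  block_minimizer J (majorant f psi phi y) u z -> l \in J ->
  convex_subgradient (psi l) (z l) (- (weight y l)^-1 *: block_grad f l z).
Proof.
move=> Dy Du zmin lJ v; have Dz := block_minimizer_dom Dy Du zmin.
have [zu zle] := zmin.
have [->|] := eqVneq (psi l v) +oo%E; first by rewrite leey.
rewrite -ltey => Dv; rewrite psi_fineE// (penalty_EFin (Hpsi l) Dv) -EFinD lee_fin.
set g := block_grad f l z; set w := weight y l; set pv := fine (psi l v).
have w0 : 0 < w by exact: weight_gt0.
rewrite linearZl /= -(ler_pM2l w0) mulrDr mulrA mulrN divff ?gt_eqF// mulN1r.
have [vz|vz] := eqVneq v (z l).
  by rewrite vz subrr linear0r oppr0 addr0 /pv vz.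
have nvz : 0 < `|v - z l| by rewrite normr_gt0 subr_eq0.
apply/ler_addgt0Pl => e e0.
have e'0 : 0 < e / `|v - z l| by rewrite divr_gt0.
have /nbhs_ballP[eta /= eta0 E] := gradient_expansion (Hf z) e'0.
pose a := Num.min (2^-1) (eta / 2 / `|v - z l|).
have a0 : 0 < a by rewrite lt_min invr_gt0 ltr0n/= !divr_gt0.
have a1 : a < 1 by rewrite gt_min invf_lt1 ?ltr0n// ltr1n.
pose za : hsum H := z + inj_block (a *: (v - z l)).
have zal : za l = a *: v + (1 - a) *: z l.
  by rewrite /za hsumDE inj_block_id scalerBr scalerBl scale1r addrCA.
have zaj j : j != l -> za j = z j.
  by move=> jl; rewrite /za hsumDE inj_block_ne// addr0.
have zaz : `|za - z| = a * `|v - z l|.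
  by rewrite /za addrAC subrr add0r normr_inj_block normrZ gtr0_norm.
have a01 : 0 < a < 1 by rewrite a0.
have [pa1 pa2] := penalty_convex_dom (Hpsi l) a01 Dv (Dz l).
have Dza : psi_dom za.
  move=> j; have [->|jl] := eqVneq j l; first by rewrite zal.
  by rewrite zaj.
have /E : ball z eta za.
  rewrite -ball_normE /= distrC zaz (@le_lt_trans _ _ (eta / 2))//.
    by rewrite -ler_pdivlMr// ge_min lexx orbT.
  by rewrite ltr_pdivrMr// ltr_pMr// ltr1n.
have -> : inner (blocks_grad f z) (za - z) = a * inner g (v - z l).
  rewrite /za addrAC subrr add0r -diff_blocks_grad// diff_inj_block//.
  by rewrite linearZr.
rewrite zaz mulrCA divfK ?gt_eqF// => /ler_normlP[_ fza].
have : majorant_fine y z <= majorant_fine y za.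
  rewrite -lee_fin -!majorantE//; apply: zle => j jJ.
  by rewrite zaj ?zu//; apply: contraNneq jJ => ->.
rewrite /majorant_fine (bigD1 l)//= [X in _ <= _ + X](bigD1 l)//=.
(* Only block [l] differs between [za] and [z], so the other summands cancel. *)
have -> : \sum_(i < L | i != l) (fine (phi i (psi_fine y i)%:E) +
    weight y i * (psi_fine za i - psi_fine y i)) =
  \sum_(i < L | i != l) (fine (phi i (psi_fine y i)%:E) +
    weight y i * (psi_fine z i - psi_fine y i)).
  apply: eq_bigr => i il.
  by have -> : psi_fine za i = psi_fine z i by rewrite /psi_fine zaj.
set S := \sum_(i < L | _) _; rewrite -/w => hmin.
have {}pa2 : psi_fine za l <= a * pv + (1 - a) * psi_fine z l by rewrite /psi_fine zal.
have wp : w * psi_fine za l <= w * (a * pv + (1 - a) * psi_fine z l) by rewrite ler_pM2l.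
rewrite -(ler_pM2l a0); move: hmin wp fza; clear; nra.
Qed.

(** Chain rule: the expansion of [f] is added to the lower expansions of the composites
    [phi l (psi l _)], block by block. *)
Lemma objective_frechet_subdiff x (s : hsum H) : psi_dom x ->
  (forall l, convex_subgradient (psi l) (x l) (s l)) ->
  frechet_subdiff (objective f psi phi) x
    (fun l => block_grad f l x + weight x l *: s l).
Proof.
move=> Dx sx; apply: frechet_subdiff_intro; first by rewrite objectiveE.
(* Half of the error goes to [f], the rest is shared by the blocks; [L.+1] avoids a division by zero
   when [L = 0]. *)
move=> e e0; pose e1 := e / 2; pose e2 := e / 2 / L.+1%:R.
have e10 : 0 < e1 by rewrite divr_gt0.
have e20 : 0 < e2 by rewrite !divr_gt0 ?ltr0n.
have E1 := gradient_expansion (Hf x) e10.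
have E2 : \forall y \near x, forall l,
  (phi l (psi l (x l)) + (weight x l * inner (s l) (y l - x l)
      - e2 * `|y l - x l|)%:E <= phi l (psi l (y l)))%E.
  apply: (@filter_forall _ 'I_L _ (nbhs x)) => l.
  have /nbhs_ballP[eta /= eta0 E] :=
    outer_penalty_expansion (Hpsi l) (Hphi l) (Dx l) (sx l) e20.
  apply/nbhs_ballP; exists eta => //= y; rewrite -ball_normE /= => xy.
  apply: E; rewrite -ball_normE /=; apply: le_lt_trans xy.
  exact: (normr_block_le (x - y) l).
near=> y.
have f1 : `|f y - f x - inner (blocks_grad f x) (y - x)| <= e1 * `|y - x|.
  by near: y; exact: E1.
have f2 l : (phi l (psi l (x l)) + (weight x l * inner (s l) (y l - x l)
    - e2 * `|y l - x l|)%:E <= phi l (psi l (y l)))%E.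
  by move: l; near: y; exact: E2.
rewrite objectiveE// -EFinD.
have Ey : ((f x + inner (blocks_grad f x) (y - x) - e1 * `|y - x|)%:E +
    \sum_l (fine (phi l (psi_fine x l)%:E) + (weight x l * inner (s l) (y l - x l)
      - e2 * `|y l - x l|))%:E <= objective f psi phi y)%E.
  apply: leeD; first by rewrite lee_fin; move/ler_normlP: f1 => [f1 _]; lra.
  apply: lee_sum => l _; apply: le_trans (f2 l).
  by rewrite psi_fineE// (outer_fin (Hphi l) (psi_fine_ge0 x l)) EFinD.
apply: le_trans Ey; rewrite sumEFin -EFinD lee_fin /objective_fine.
rewrite big_split/= sumrB -mulr_sumr.
set t : hsum H := fun l => _.
have -> : inner t (y - x) = inner (blocks_grad f x) (y - x) +
    \sum_l weight x l * inner (s l) (y l - x l).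
  rewrite !inner_hsumE -big_split/=; apply: eq_bigr => l _.
  by rewrite linearDl linearZl.
have : \sum_l `|y l - x l| <= L.+1%:R * `|y - x|.
  apply: (@le_trans _ _ (\sum_(l < L) `|y - x|)).
    by apply: ler_sum => l _; exact: (normr_block_le (y - x) l).
  by rewrite sumr_const card_ord -[leLHS]mulr_natl ler_wpM2r// ler_nat.
have e2E : e2 * L.+1%:R = e / 2 by rewrite /e2 divfK ?pnatr_eq0.
move=> /(ler_wpM2l (ltW e20)); rewrite mulrA e2E /e1.
rewrite -[hinner _ _]/(inner (blocks_grad f x) (y - x)); lra.
Unshelve. all: by end_near. Qed.

End composite.

(** * Finite length from the Kurdyka-Łojasiewicz inequality *)

Section concave_tangent.
Context {R : realType} (r : \bar R) (h : R -> R).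
Hypothesis hr : desingularizing r h.

(** As for [outer_tangent]: concavity on the segment from [a] to [b], combined with the derivative
    at [a] for a small fraction [th]. *)
Lemma desing_tangent (a b : R) : 0 < a -> (a%:E < r)%E -> 0 <= b -> (b%:E < r)%E ->
  h b <= h a + derive1 h a * (b - a).
Proof.
move=> a0 ar b0 br; apply/ler_addgt0Pl => e e0.
have [->|ba] := eqVneq b a; first by rewrite subrr mulr0 addr0 lerDr ltW.
have nba : 0 < `|b - a| by rewrite normr_gt0 subr_eq0.
have e'0 : 0 < e / `|b - a| by rewrite divr_gt0.
have [da _ _] := desing_C1 hr a0 ar.
have : t^-1 *: ((h \o shift a) (t *: 1) - h a) @[t --> 0^'] --> derive1 h a.
  by rewrite derive1E.
move=> /cvgrPdist_le/(_ _ e'0) E0.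
have E : \forall t \near (0 : R), t != 0 ->
    `|derive1 h a - t^-1 *: ((h \o shift a) (t *: 1) - h a)| <= e / `|b - a| by exact: E0.
move: E => /nbhs_ballP[eta /= eta0 E].
pose th := Num.min (2^-1) (eta / 2 / `|b - a|).
have th0 : 0 < th by rewrite lt_min invr_gt0 ltr0n/= !divr_gt0.
have th1 : th < 1 by rewrite gt_min invf_lt1 ?ltr0n// ltr1n.
have ut : `|th * (b - a)| = th * `|b - a| by rewrite normrM gtr0_norm.
have t0 : th * (b - a) != 0 by rewrite mulf_eq0 negb_or subr_eq0 ba gt_eqF.
have /E/(_ t0) : ball 0 eta (th * (b - a)).
  rewrite /ball/= sub0r normrN ut.
  rewrite (@le_lt_trans _ _ (eta / 2))//; last by rewrite ltr_pdivrMr// ltr_pMr// ltr1n.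
  by rewrite -ler_pdivlMr// ge_min lexx orbT.
have th01 : 0 <= th <= 1 by rewrite !ltW.
have c := desing_concave hr b0 br (ltW a0) ar th01.
rewrite distrC -(@ler_pM2r _ `|th * (b - a)|) ?normr_gt0// -normrM mulrBl.
rewrite /= /GRing.scale/= mulr1 [_^-1 * _ * _]mulrAC mulVf// mul1r ut.
rewrite [e / _ * _]mulrCA divfK ?gt_eqF//.
have thE : th * b + (1 - th) * a = th * (b - a) + a by ring.
rewrite thE in c.
move=> /ler_normlP[_ k].
rewrite -(ler_pM2l th0); move: c k; nra.
Qed.

Lemma desing_small (e : R) : (0 < r)%E -> 0 < e ->
  exists2 d : R, 0 < d & forall t, 0 <= t -> t < d -> (t%:E < r)%E /\ h t < e.
Proof.
move=> r0 e0.
have /subspace_continuousP/(_ 0) := desing_continuous hr.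
move=> /(_ (conj (lexx 0) r0)) /cvgrPdist_lt/(_ _ e0) E0.
have E : \forall t \near (0 : R), 0 <= t /\ (t%:E < r)%E -> `|h 0 - h t| < e by exact: E0.
move: E => /nbhs_ballP[eta /= eta0 E].
have [d d0 dr] : exists2 d : R, 0 < d & (d%:E <= r)%E.
  move: r0; case: r => [q| |//]; last by exists 1; rewrite ?leey.
  by rewrite lte_fin => q0; exists q.
exists (Num.min d eta); first by rewrite lt_min d0.
move=> t t0; rewrite lt_min => /andP[td te].
have tr : (t%:E < r)%E by rewrite (lt_le_trans _ dr)// lte_fin.
split=> //; have := E t; rewrite /ball/= sub0r normrN ger0_norm// => /(_ te (conj t0 tr)).
by rewrite (desing_at0 hr) sub0r normrN; apply: le_lt_trans; exact: ler_norm.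
Qed.

End concave_tangent.

Section finite_length.
Context {R : realType} {V : normedModType R}.
Variables (x : nat -> V) (S v : nat -> R) (xhat : V) (vhat c C delta : R).
Variables (r : \bar R) (h : R -> R) (N0 : nat).
Hypotheses (c0 : 0 < c) (C0 : 0 <= C) (delta0 : 0 < delta) (r0 : (0 < r)%E).
Hypothesis hr : desingularizing r h.
Hypothesis S0 : forall k, 0 <= S k.
Hypothesis step : forall k, `|x k.+1 - x k| <= S k.
Hypothesis descent : forall k, c * S k ^+ 2 <= v k - v k.+1.
Hypothesis v_cvg : v @ \oo --> vhat.
Hypothesis x_cluster : forall (e : R) N, 0 < e ->
  exists2 k, (N <= k)%N & `|x k - xhat| < e.
(** The index shifts because the subgradient at the iterate [k.+1] is controlled by the inner path
    of iteration [k] that leads to it. *)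
Hypothesis KL : forall k, (N0 <= k)%N -> `|x k.+1 - xhat| < delta ->
  vhat < v k.+1 -> ((v k.+1)%:E < vhat%:E + r)%E ->
  1 <= derive1 h (v k.+1 - vhat) * (C * S k).

Let step_sum m j : `|x (m + j)%N - x m| <= \sum_(i < j) S (m + i)%N.
Proof.
elim: j => [|j IHj]; first by rewrite addn0 subrr normr0 big_ord0.
rewrite big_ord_recr/= addnS (le_trans (ler_distD (x (m + j)%N) _ _))//.
by rewrite addrC lerD.
Qed.

Let v_step k : v k.+1 <= v k.
Proof.
rewrite -subr_ge0 (le_trans _ (descent k))//.
by rewrite mulr_ge0 ?sqr_ge0// ltW.
Qed.

Let v_anti : nonincreasing_seq v.
Proof. by apply/nonincreasing_seqP => k; exact: v_step. Qed.

Let v_ge k : vhat <= v k.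
Proof.
rewrite -(cvg_lim _ v_cvg)//; apply: nonincreasing_cvgn_ge => //.
by apply/cvg_ex; exists vhat.
Qed.

Let series_add m j : series S (m + j)%N = series S m + \sum_(i < j) S (m + i)%N.
Proof.
rewrite /series/= (@big_cat_nat _ _ _ m) ?leq_addr//=; congr +%R.
by rewrite -{1}[m]add0n big_addn addKn big_mkord; apply: eq_bigr => i _; rewrite addnC.
Qed.

Let cvg_of_tail_bound m (B : R) : (forall j, \sum_(i < j) S (m + i)%N <= B) ->
  cvg (series S @ \oo).
Proof.
move=> SB; apply: nondecreasing_is_cvgn; first exact: nondecreasing_series.
exists (series S m + B) => _ [n _ <-].
apply: (@le_trans _ _ (series S (m + n))).
  by apply: nondecreasing_series => //; rewrite leq_addl.
by rewrite series_add lerD2l.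
Qed.

(** If [v] reaches its limit, descent makes [S] vanish from there on. Otherwise the KL inequality is
    available only near [xhat]: a start [m] is chosen so good that the length bound itself keeps all
    later iterates within [delta]. *)
Lemma KL_summable : cvg (series S @ \oo).
Proof.
have [[m vm]|vne] := pselect (exists m, v m = vhat).
  apply: (@cvg_of_tail_bound m 0) => j; rewrite big1// => i _.
  have vi k : (m <= k)%N -> v k = vhat.
    by move=> mk; apply/eqP; rewrite eq_le v_ge -vm v_anti.
  have := descent (m + i); rewrite !vi ?leq_addr//; last by rewrite -addnS leq_addr.
  rewrite subrr pmulr_rle0// => Si; apply/eqP; rewrite -sqrf_eq0.
  by rewrite eq_le Si sqr_ge0.
have v_gt k : vhat < v k.
  rewrite lt_def v_ge andbT; apply/eqP => vk; apply: vne; by exists k.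
(* The distance from [x m.+1] to [xhat], [S m] and [D * De m.+1] will each be below [eta], hence
   below [delta] in total. *)
pose D := C / c; pose eta := delta / 4.
have D0 : 0 <= D by rewrite divr_ge0// ltW.
have eta0 : 0 < eta by rewrite divr_gt0.
(* Division by [D + 1] since [D] may be 0. *)
have eta'0 : 0 < eta / (D + 1) by rewrite divr_gt0// ltr_wpDl.
have [d d0 hd] := desing_small hr r0 eta'0.
(* A gap below [d] makes [h] small; a gap below [c * eta ^+ 2] gives [S m < eta] by descent. *)
have cd0 : 0 < Num.min d (c * eta ^+ 2) by rewrite lt_min d0 mulr_gt0// exprn_gt0.
have [N1 _ vN] : \forall k \near \oo, `|vhat - v k| < Num.min d (c * eta ^+ 2).
  by have /cvgrPdist_lt := v_cvg; apply.
(* The close iterate is taken of the form [m.+1], the form in which [KL] applies. *)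
have [[//|m] mN xm] := x_cluster (maxn N0 N1).+1 eta0.
rewrite ltnS geq_max in mN; have /andP[mN0 mN1] := mN.
have vsmall k : (m <= k)%N ->
    [/\ 0 < v k - vhat, v k - vhat < d & v k - vhat < c * eta ^+ 2].
  move=> mk; have := vN k (leq_trans mN1 mk).
  rewrite distrC gtr0_norm ?subr_gt0// lt_min => /andP[-> ->].
  by rewrite v_gt.
have vr k : (m <= k)%N -> ((v k - vhat)%:E < r)%E.
  by move=> /vsmall[/ltW k0 kd _]; have [] := hd _ k0 kd.
pose De k := h (v k - vhat).
have De0 k : (m <= k)%N -> 0 <= De k.
  by move=> mk; apply: (desing_ge0 hr); [rewrite subr_ge0|exact: vr].
have Sm : S m < eta.
  have [_ _ vm] := vsmall m (leqnn m).
  have : S m ^+ 2 < eta ^+ 2.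
    by rewrite -(ltr_pM2l c0) (le_lt_trans (descent m))// (le_lt_trans _ vm)// lerB.
  by rewrite ltr_sqr ?nnegrE// ltW.
have Dem : D * De m.+1 < eta.
  have [/ltW m0 md _] := vsmall m.+1 (leqnSn m).
  have [_ hm] := hd _ m0 md.
  rewrite (@le_lt_trans _ _ (D * (eta / (D + 1))))//; first by rewrite ler_wpM2l// ltW.
  by rewrite mulrCA gtr_pMr// ltr_pdivrMr ?ltr_wpDl// mul1r ltrDl.
(* Sum of the inequalities [2 * S k.+1 <= S k + D * (De k.+1 - De k.+2)]. The induction also yields
   that the next iterate is within [delta], which the next use of [KL] requires. *)
have Q j : \sum_(i < j) S (m.+1 + i)%N + S (m + j)%N
    <= S m + D * (De m.+1 - De (m + j).+1).
  elim: j => [|j IHj]; first by rewrite big_ord0 addn0 subrr mulr0 addr0 add0r.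
  have mj : (m <= (m + j).+1)%N by rewrite leqW// leq_addr.
  have mj1 : (m <= (m + j).+2)%N by rewrite leqW.
  have near : `|x (m + j).+1 - xhat| < delta.
    have := De0 _ mj; have := S0 (m + j) => s2 /(mulr_ge0 D0) s3.
    have s1 : `|x (m + j).+1 - x m.+1| <= \sum_(i < j) S (m.+1 + i)%N.
      by have := step_sum m.+1 j; rewrite addSn.
    apply: le_lt_trans (ler_distD (x m.+1) _ _) _.
    by move: delta0 s1 xm s2 Sm Dem IHj s3; rewrite /eta mulrBr; lra.
  have vr1 : ((v (m + j).+1)%:E < vhat%:E + r)%E.
    by have := vr _ mj; rewrite EFinB lteBlDl.
  have kl := KL (leq_trans mN0 (leq_addr j m)) near (v_gt _) vr1.
  have [dm _ _] := vsmall _ mj; have [dm1 _ _] := vsmall _ mj1.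
  have t := desing_tangent hr dm (vr _ mj) (ltW dm1) (vr _ mj1).
  rewrite -/(De (m + j).+1) -/(De (m + j).+2) in t.
  have [_ _ q0] := desing_C1 hr dm (vr _ mj).
  set q := derive1 h _ in kl t q0.
  set s := S (m + j) in IHj kl *; set s' := S (m + j).+1.
  set A := De (m + j).+1 in IHj t *; set A' := De (m + j).+2 in t *.
  have s0 : 0 <= s by exact: S0.
  have s'0 : 0 <= s' by exact: S0.
  have AA : q * (c * s' ^+ 2) <= A - A'.
    apply: (@le_trans _ _ (q * (v (m + j).+1 - v (m + j).+2))).
      exact: ler_wpM2l (ltW q0) _ _ (descent _).
    by move: t; rewrite opprB addrA subrK; lra.
  (* The inequality [1 <= q * (C * s)] eliminates the slope [q] from [AA]. *)
  have key : s' ^+ 2 <= s * (D * (A - A')).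
    have E : c * (s * (C / c * (A - A'))) = C * s * (A - A') by field; rewrite gt_eqF.
    rewrite -(ler_pM2l c0) /D E.
    apply: (@le_trans _ _ (q * (C * s) * (c * s' ^+ 2))).
      by rewrite ler_peMl// mulr_ge0 ?sqr_ge0// ltW.
    by rewrite mulrAC mulrC ler_wpM2l// mulr_ge0.
  have DA0 : 0 <= D * (A - A').
    apply: mulr_ge0 => //; apply: le_trans AA; apply: mulr_ge0; first exact: ltW.
    by apply: mulr_ge0; [exact: ltW|exact: sqr_ge0].
  (* Arithmetic-geometric mean inequality for [s] and [D * (A - A')]. *)
  have am : 2 * s' <= s + D * (A - A').
    rewrite -ler_sqr ?nnegrE ?mulr_ge0 ?addr_ge0//.
    set B := D * (A - A') in key DA0 *.
    have := sqr_ge0 (s - B); move: key; nra.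
  rewrite big_ord_recr/= addSn addnS -/s' -/A'.
  move: am IHj; rewrite !mulrBr; lra.
apply: (@cvg_of_tail_bound m.+1 (S m + D * De m.+1)) => j.
have mj : (m <= (m + j).+1)%N by rewrite leqW// leq_addr.
have := Q j; have := De0 _ mj; have := S0 (m + j) => s2 /(mulr_ge0 D0) s3.
rewrite mulrBr; lra.
Qed.

(** Tails of the lengths are small, so one late iterate close to [xhat] keeps all later ones
    close. *)
Lemma KL_cvg : x @ \oo --> xhat.
Proof.
apply/cvgrPdist_lt => e e0; have e4 : 0 < e / 4 by rewrite divr_gt0.
have /cvg_ex[l /cvgrPdist_lt/(_ _ e4)[N _ SN]] := KL_summable.
have [k Nk xk] := x_cluster N e4.
exists k => // n /= kn.
have := step_sum k (n - k); have := series_add k (n - k); rewrite subnKC// => sE.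
have := SN _ Nk; have := SN n (leq_trans Nk kn) => /ltr_normlP[n1 n2] /ltr_normlP[k1 k2] xn.
rewrite distrC (le_lt_trans (ler_distD (x k) _ _))//.
move: xn; rewrite -[X in _ <= X -> _](addKr (series S k)) -sE; lra.
Qed.

End finite_length.

(** * Limits of iterates *)

Section limits.
Context {R : realType}.

(** Lipschitz continuity on the domain bounds [F] by [B] along [u] near [p]; were [F p] infinite,
    lower semicontinuity would push [F] above [B] there. *)
Lemma penalty_dom_closed (V : innerType R) (F : V -> \bar R) (T : Type)
    (G : set_system T) (u : T -> V) (p : V) :
  regular_block_penalty F -> ProperFilter G -> u @ G --> p ->
  (forall n, (F (u n) < +oo)%E) -> (F p < +oo)%E.
Proof.
move=> HF GG up Fu; rewrite ltey; apply/eqP => Fp.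
have [K K0 HK] := penalty_lipschitz_dom HF.
have [n0 _] : exists n0 : T, setT n0 by apply: (@filter_ex _ G GG setT); exact: filterT.
pose B := fine (F (u n0)) + K * (1 + `|p - u n0|).
have BFp : (B%:E < F p)%E by rewrite Fp ltry.
have [U pU UB] := penalty_lsc HF BFp.
have G1 : G [set n | U (u n)] by exact: up.
have G2 : G [set n | `|p - u n| < 1].
  by have /cvgrPdist_lt/(_ _ ltr01) := up.
have [n [/UB Bn un]] := @filter_ex _ G GG _ (filterI G1 G2).
move: Bn; rewrite (penalty_EFin HF (Fu n)) lte_fin; apply/negP; rewrite -leNgt.
have := HK _ _ (Fu n) (Fu n0) => /ler_normlP[_ h1].
have h2 : `|u n - u n0| <= 1 + `|p - u n0|.
  by rewrite (le_trans (ler_distD p _ _))// lerD// distrC ltW.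
by rewrite /B -lerBlDl (le_trans h1)// ler_wpM2l// ltW.
Qed.

(** The expansion at [t] with error 1 is a local Lipschitz bound of constant [k]. *)
Lemma outer_cvg (h : \bar R -> \bar R) (T : Type) (G : set_system T)
    (u : T -> R) (t : R) :
  regular_concave h -> Filter G -> (forall n, 0 <= u n) -> 0 <= t ->
  u @ G --> t -> fine (h (u n)%:E) @[n --> G] --> fine (h t%:E).
Proof.
move=> hh GG u0 t0 ut; apply/cvgrPdist_lt => e e0.
pose k := `|deriv_halfline h t| + 1.
have k0 : 0 < k by rewrite ltr_wpDl.
have E : \forall n \near G, 0 <= u n ->
  `|fine (h (u n)%:E) - fine (h t%:E) - deriv_halfline h t * (u n - t)|
     <= 1 * `|u n - t|.
  exact: ut (outer_expansion hh t0 ltr01).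
have ek : 0 < e / k by rewrite divr_gt0.
have /cvgrPdist_lt/(_ _ ek) E2 := ut.
apply: filterS2 E E2 => n /(_ (u0 n)) + un.
set a := fine _; set b := fine _ => ab.
rewrite distrC -(subrK (deriv_halfline h t * (u n - t)) (a - b)).
rewrite (le_lt_trans (ler_normD _ _))//.
rewrite (@le_lt_trans _ _ (k * `|u n - t|))//.
  by rewrite /k mulrDl addrC lerD// normrM.
by rewrite mulrC -ltr_pdivlMr// distrC.
Qed.

End limits.

Section composite_limits.
Context {R : realType} {L : nat} {H : 'I_L -> euclideanType R}.
Variables (f : hsum H -> R) (psi : forall l, H l -> \bar R)
  (phi : 'I_L -> \bar R -> \bar R).
Arguments psi : clear implicits.
Hypotheses (Hf : forall x, differentiable f x)
  (Hpsi : forall l, regular_block_penalty (psi l))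
  (Hphi : forall l, regular_concave (phi l)).
Implicit Types (x y z u : hsum H).

Lemma block_cvg (T : Type) (G : set_system T) (u : T -> hsum H) (p : hsum H) l :
  Filter G -> u @ G --> p -> u n l @[n --> G] --> p l.
Proof.
move=> GG up; apply/cvgrPdist_lt => e e0.
have /cvgrPdist_lt/(_ _ e0) := up; apply: filterS => n; apply: le_lt_trans.
exact: (normr_block_le (p - u n) l).
Qed.

Lemma psi_dom_closed (T : Type) (G : set_system T) (u : T -> hsum H) (p : hsum H) :
  ProperFilter G -> u @ G --> p -> (forall n, psi_dom psi (u n)) -> psi_dom psi p.
Proof.
move=> GG up Du l; apply: (penalty_dom_closed (Hpsi l) GG (block_cvg (l := l) _ up)).
by move=> n; exact: Du.
Qed.

Lemma psi_fine_lipschitz l : exists2 K : R, 0 < K &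
  forall x y, psi_dom psi x -> psi_dom psi y ->
    `|psi_fine psi x l - psi_fine psi y l| <= K * `|x - y|.
Proof.
have [K K0 HK] := penalty_lipschitz_dom (Hpsi l).
exists K => // x y Dx Dy; rewrite (le_trans (HK _ _ (Dx l) (Dy l)))//.
by rewrite ler_wpM2l ?(ltW K0)//; exact: (normr_block_le (x - y) l).
Qed.

Lemma objective_fine_cvg (T : Type) (G : set_system T) (u : T -> hsum H) (p : hsum H) :
  ProperFilter G -> u @ G --> p -> (forall n, psi_dom psi (u n)) ->
  objective_fine f psi phi (u n) @[n --> G] --> objective_fine f psi phi p.
Proof.
move=> GG up Du; have Dp := psi_dom_closed GG up Du.
apply: cvgD.
  by apply: (cvg_comp _ _ up); exact: differentiable_continuous.
apply: cvg_big => [|l _]; first exact: add_continuous.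
apply: outer_cvg => //.
- by move=> n; exact: psi_fine_ge0.
- exact: psi_fine_ge0.
have [K K0 HK] := psi_fine_lipschitz l.
apply/cvgrPdist_lt => e e0; have eK : 0 < e / K by rewrite divr_gt0.
have /cvgrPdist_lt/(_ _ eK) := up; apply: filterS => n un.
by rewrite (le_lt_trans (HK _ _ Dp (Du n)))// mulrC -ltr_pdivlMr.
Qed.

(** To be used with [x] and [y] two successive outer iterates and [z] the inner iterate that last
    updated block [l]. The vector splits into [gy - gz], bounded by the Lipschitz gradient, and [gz]
    times the relative change of weight. *)
Lemma block_subgradient_bound (beta : 'I_L -> 'I_L -> R) (p : hsum H) l :
  (forall j, 0 < beta l j) ->
  (forall j x (v : H j),
    `|block_grad f l (x + inj_block v) - block_grad f l x| <= beta l j * `|v|) ->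
  psi_dom psi p ->
  exists2 C : R, 0 <= C & exists2 rho : R, 0 < rho &
  forall x y z (S : R), psi_dom psi x -> psi_dom psi y ->
    `|x - p| < rho -> `|y - p| < rho -> `|z - p| < rho ->
    `|y - x| <= S -> `|y - z| <= S ->
  `|block_grad f l y + weight psi phi y l *:
      (- (weight psi phi x l)^-1 *: block_grad f l z)| <= C * S.
Proof.
move=> beta0 Hbeta Dp.
have lip := block_grad_lipschitz (fun j => ltW (beta0 j)) Hbeta.
set B := \sum_j beta l j in lip.
have B0 : 0 <= B by apply: sumr_ge0 => j _; exact: ltW.
have [K K0 HK] := psi_fine_lipschitz l.
have p0 := psi_fine_ge0 Hpsi p l.
have [Kd Kd0 [e e0 HKd]] := outer_deriv_locally_lipschitz (Hphi l) p0.
have pe0 : 0 <= psi_fine psi p l + e by rewrite addr_ge0// ltW.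
(* The derivative decreases, so [w0] bounds from below the weights at points whose [psi] value is
   within [e] of that at [p]. *)
pose w0 := deriv_halfline (phi l) (psi_fine psi p l + e).
have w00 : 0 < w0 by have := outer_deriv_gt0 (Hphi l) pe0.
pose g0 := `|block_grad f l p| + B.
have g00 : 0 <= g0 by rewrite addr_ge0.
exists (B + Kd * K / w0 * g0).
  by rewrite addr_ge0// mulr_ge0// divr_ge0 ?(ltW w00)// mulr_ge0// ltW.
(* Radius 1 bounds the gradient at [z] by [g0]; radius [e / K] keeps the [psi] values within [e]. *)
exists (Num.min 1 (e / K)); first by rewrite lt_min ltr01 divr_gt0.
move=> x y z S Dx Dy; rewrite !lt_min => /andP[_ xp] /andP[_ yp] /andP[zp _] yx yz.
have S0 : 0 <= S by exact: le_trans yx.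
have near u : psi_dom psi u -> `|u - p| < e / K ->
    `|psi_fine psi u l - psi_fine psi p l| < e.
  move=> Du up; rewrite (le_lt_trans (HK _ _ Du Dp))//.
  by rewrite mulrC -ltr_pdivlMr.
set wy := weight psi phi y l; set wx := weight psi phi x l.
have wx0 : w0 <= wx.
  apply: outer_deriv_antitone; [exact: Hphi|exact: psi_fine_ge0|].
  by have := near _ Dx xp => /ltr_normlP[_]; lra.
have wxp : 0 < wx by exact: lt_le_trans wx0.
have wxy : `|wx - wy| <= Kd * K * S.
  have := HKd _ _ (psi_fine_ge0 Hpsi x l) (psi_fine_ge0 Hpsi y l) (near _ Dx xp) (near _ Dy yp).
  move=> /le_trans; apply; rewrite -mulrA ler_wpM2l ?(ltW Kd0)//.
  rewrite (le_trans (HK _ _ Dx Dy))// ler_wpM2l ?(ltW K0)//.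
  by rewrite distrC.
set gy := block_grad f l y; set gz := block_grad f l z.
have gzle : `|gz| <= g0.
  rewrite -[gz](subrK (block_grad f l p)) (le_trans (ler_normD _ _))// addrC lerD//.
  by rewrite (le_trans (lip _ _))// ler_piMr// ltW.
have -> : gy + wy *: (- wx^-1 *: gz) = (gy - gz) + ((wx - wy) / wx) *: gz.
  rewrite scalerA mulrN scaleNr mulrBl divff ?gt_eqF// scalerBl scale1r.
  by rewrite addrA subrK.
rewrite (le_trans (ler_normD _ _))// [leRHS]mulrDl lerD//.
  by rewrite (le_trans (lip _ _))// ler_wpM2l.
rewrite normrZ normrM normfV (gtr0_norm wxp) [leRHS]mulrAC ler_pM//.
  by rewrite divr_ge0// ltW.
rewrite ler_pdivrMr// (le_trans wxy)//.
have -> : Kd * K / w0 * S * wx = Kd * K * S * (wx / w0) by ring.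
by rewrite ler_peMr ?mulr_ge0 ?(ltW K0) ?(ltW Kd0)// ler_pdivlMr// mul1r.
Qed.

End composite_limits.

(** * The Gauss-Seidel algorithm *)

Lemma normrB_le_sum {R : realType} {V : normedModType R} (u : nat -> V) (m n : nat) :
  (m <= n)%N -> `|u n - u m| <= \sum_(i < n) `|u i.+1 - u i|.
Proof.
elim: n => [|n IHn]; first by rewrite leqn0 => /eqP ->; rewrite subrr normr0 big_ord0.
rewrite leq_eqVlt => /predU1P[->|].
  by rewrite subrr normr0; apply: sumr_ge0.
rewrite ltnS => /IHn h; rewrite big_ord_recr/= (le_trans (ler_distD (u n) _ _))//.
by rewrite addrC lerD.
Qed.

(** Cauchy-Schwarz against the constant 1; the induction step comes from [(A - n b) ^ 2 >= 0]. *)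
Lemma sqr_sum_le {R : realType} (n : nat) (a : nat -> R) :
  (\sum_(i < n) a i) ^+ 2 <= n%:R * \sum_(i < n) a i ^+ 2.
Proof.
elim: n => [|n IHn]; first by rewrite !big_ord0 expr0n mul0r.
rewrite !big_ord_recr/=; set A := \sum_(_ < _) _ in IHn *.
set Q := \sum_(_ < _) _ in IHn *; set b := a n.
have [n0|n0] := posnP n.
  by rewrite /A /Q n0 !big_ord0 !add0r mul1r.
have nR0 : 0 < (n%:R : R) by rewrite ltr0n.
rewrite -natr1 -(ler_pM2l nR0); have := sqr_ge0 (A - n%:R * b).
move: IHn nR0; set N := n%:R; nra.
Qed.

Section algorithm.
Context {R : realType} {L : nat} {H : 'I_L -> euclideanType R}.
Variables (f : hsum H -> R) (psi : forall l, H l -> \bar R)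
  (phi : 'I_L -> \bar R -> \bar R).
Arguments psi : clear implicits.
Hypotheses (Hpsi : forall l, regular_block_penalty (psi l))
  (Hphi : forall l, regular_concave (phi l)).
Variables (I : nat -> nat) (J : nat -> nat -> {set 'I_L})
  (x : nat -> hsum H) (xt : nat -> nat -> hsum H).
Hypothesis HGS : CO_GS f psi phi I J x xt.

Lemma CO_GS_inner_dom k i : (i <= I k)%N -> psi_dom psi (xt k i).
Proof.
have inner_dom k' : psi_dom psi (x k') -> forall j, (j <= I k')%N -> psi_dom psi (xt k' j).
  move=> Dx; elim=> [_|j IHj jI]; first by rewrite (GS_start HGS).
  have [zmin _] := GS_step HGS jI.
  exact: (block_minimizer_dom Hpsi Hphi Dx (IHj (ltnW jI)) zmin).
move: i; apply: (inner_dom); elim: k => [l|k IHk]; first exact: (GS_dom_block HGS).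
by rewrite (GS_end HGS); exact: inner_dom.
Qed.

Lemma CO_GS_dom k : psi_dom psi (x k).
Proof. by rewrite -(GS_start HGS); exact: CO_GS_inner_dom. Qed.

Definition inner_length k : R := \sum_(i < I k) `|xt k i.+1 - xt k i|.

Lemma inner_length_ge0 k : 0 <= inner_length k.
Proof. exact: sumr_ge0. Qed.

Lemma CO_GS_dist k i : (i <= I k)%N -> `|x k.+1 - xt k i| <= inner_length k.
Proof. by move=> iI; rewrite (GS_end HGS); exact: (normrB_le_sum (xt k)). Qed.

Lemma CO_GS_step k : `|x k.+1 - x k| <= inner_length k.
Proof. by rewrite -(GS_start HGS k); exact: CO_GS_dist. Qed.

(** The decreases of the majorant at [x k] add up over the inner steps; with at most [Ibar] steps,
    [sqr_sum_le] passes from the sum of squares to the square of the path length. *)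
Lemma CO_GS_descent (mu : nat -> nat -> R) (mu_lo : R) (Ibar k : nat) :
  (forall i, (i < I k)%N -> mu_lo <= mu k i /\
    strongly_convex_wrt psi (J k i) (mu k i) (majorant f psi phi (x k))) ->
  0 < mu_lo -> (0 < I k <= Ibar)%N ->
  mu_lo / 4 / Ibar%:R * inner_length k ^+ 2 <=
    objective_fine f psi phi (x k) - objective_fine f psi phi (x k.+1).
Proof.
move=> sc mu0 /andP[Ik0 IkI]; pose M := majorant_fine f psi phi (x k).
have Dx := CO_GS_dom k.
have sum_descent i : (i <= I k)%N ->
    M (xt k i) + mu_lo / 4 * \sum_(j < i) `|xt k j.+1 - xt k j| ^+ 2 <= M (x k).
  elim: i => [_|i IHi iI].
    by rewrite big_ord0 mulr0 addr0 (GS_start HGS).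
  have [zmin _] := GS_step HGS iI; have [mui sci] := sc i iI.
  have d := majorant_descent Hpsi Hphi Dx (CO_GS_inner_dom (ltnW iI)) zmin sci.
  have := IHi (ltnW iI); rewrite big_ord_recr/= mulrDr.
  have : mu_lo / 4 * `|xt k i.+1 - xt k i| ^+ 2 <= mu k i / 4 * `|xt k i.+1 - xt k i| ^+ 2.
    by rewrite ler_wpM2r ?sqr_ge0// ler_pM2r.
  by rewrite -/M in d; lra.
have := sum_descent _ (leqnn _); rewrite -(GS_end HGS) {2}/M majorant_fine_diag.
have := objective_le_majorant f Hpsi Hphi (x k) (x k.+1); rewrite -/M.
have Ibar0 : 0 < (Ibar%:R : R) by rewrite ltr0n (leq_trans Ik0).
have : mu_lo / 4 / Ibar%:R * inner_length k ^+ 2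
    <= mu_lo / 4 * \sum_(j < I k) `|xt k j.+1 - xt k j| ^+ 2.
  rewrite -mulrA ler_wpM2l// ?divr_ge0// ?(ltW mu0)// ler_pdivrMl//.
  rewrite (le_trans (sqr_sum_le (I k) (fun i => `|xt k i.+1 - xt k i|)))// ler_wpM2r ?ler_nat//.
  by apply: sumr_ge0 => i _; rewrite sqr_ge0.
lra.
Qed.

Hypothesis HI : forall k l, exists2 i, (i < I k)%N & l \in J k i.

(** For the greatest index [i] that updates block [l], later inner steps leave the block fixed. *)
Lemma last_update k l : exists i, [/\ (i < I k)%N, l \in J k i & xt k i.+1 l = x k.+1 l].
Proof.
have exP : exists i, (i < I k)%N && (l \in J k i).
  by have [i iI lJ] := HI k l; exists i; rewrite iI.
have ub i : (i < I k)%N && (l \in J k i) -> (i <= I k)%N by move=> /andP[/ltnW].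
case: (ex_maxnP exP ub) => i /andP[iI lJ] imax; exists i; split=> //.
rewrite (GS_end HGS); have stay j : (i < j)%N -> (j <= I k)%N -> xt k i.+1 l = xt k j l.
  elim: j => // j IHj; rewrite ltnS leq_eqVlt => /predU1P[<-//|ij] jI.
  have [[step _] _] := GS_step HGS jI.
  rewrite step; first exact: IHj ij (ltnW jI).
  by apply/negP => ljJ; have := imax j; rewrite jI ljJ leqNgt ij => /(_ isT).
exact: stay.
Qed.

Hypothesis Hf : forall y, differentiable f y.
Hypothesis Hlip : exists beta : 'I_L -> 'I_L -> R,
    forall l j, 0 < beta l j /\ forall y (v : H j),
      `|block_grad f l (y + inj_block v) - block_grad f l y| <= beta l j * `|v|.

Lemma CO_GS_subgradient_bound (p : hsum H) : psi_dom psi p ->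
  exists2 C : R, 0 <= C & exists2 delta : R, 0 < delta &
  forall k, inner_length k < delta -> `|x k.+1 - p| < delta ->
  exists2 t, frechet_subdiff (objective f psi phi) (x k.+1) t &
    `|t| <= C * inner_length k.
Proof.
move=> Dp; have [beta Hbeta] := Hlip.
have bound l := block_subgradient_bound Hpsi Hphi
  (fun j => (Hbeta l j).1) (fun j => (Hbeta l j).2) Dp.
pose C l := projT1 (cid2 (bound l)).
have C0 l : 0 <= C l by rewrite /C; case: cid2.
have boundC l := projT2 (cid2 (bound l)).
have /choice[rho Hrho] l : exists rho : R, 0 < rho /\
  forall x y z (S : R), psi_dom psi x -> psi_dom psi y ->
    `|x - p| < rho -> `|y - p| < rho -> `|z - p| < rho ->
    `|y - x| <= S -> `|y - z| <= S ->
  `|block_grad f l y + weight psi phi y l *: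
      (- (weight psi phi x l)^-1 *: block_grad f l z)| <= C l * S.
  by rewrite /C; case: cid2 => c /= _ [r r0 hr]; exists r.
(* A common radius for all blocks, taken in the right neighbourhoods of 0 so that [L = 0] is
   covered. *)
have [d d0 dlt] : exists2 d : R, 0 < d & forall l, d < rho l.
  have /filter_ex[d [dl d0]] : \forall d \near 0^'+, (forall l, d < rho l) /\ 0 < d.
    apply: filterI; last exact: nbhs_right_gt.
    apply: (@filter_forall R 'I_L (fun l d => d < rho l) (0 : R)^'+) => l.
    by apply: nbhs_right_lt; have [] := Hrho l.
  by exists d.
exists (\sum_l C l); first exact: sumr_ge0.
(* Inner iterates are within [inner_length k] of [x k.+1], hence within [d] of [p]. *)
exists (d / 2); first by rewrite divr_gt0.
move=> k Sk xk; set x' := x k.+1 in xk *.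
have /choice[i Hi] l := last_update k l.
pose s : hsum H := fun l => - (weight psi phi (x k) l)^-1 *: block_grad f l (xt k (i l).+1).
have close j : (j <= I k)%N -> `|xt k j - p| < d.
  move=> jI; rewrite (le_lt_trans (ler_distD x' _ _))// distrC.
  by have := CO_GS_dist jI; rewrite -/x'; lra.
exists (fun l => block_grad f l x' + weight psi phi x' l *: s l).
  apply: objective_frechet_subdiff => // [|l]; first exact: CO_GS_dom.
  have [il lJ xil] := Hi l; rewrite /x' -xil.
  have [zmin _] := GS_step HGS il.
  exact: (block_optimality Hf Hpsi Hphi (CO_GS_dom k) (CO_GS_inner_dom (ltnW il)) zmin lJ).
rewrite (le_trans (normr_hsum_le _))// mulr_suml; apply: ler_sum => l _.
have [il lJ xil] := Hi l; have [_ hr] := Hrho l.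
apply: hr => //.
- exact: CO_GS_dom.
- exact: CO_GS_dom.
- by rewrite -(GS_start HGS) (lt_trans (close _ _)).
- by rewrite (lt_trans xk)// (le_lt_trans _ (dlt l))//; lra.
- exact: lt_trans (close _ il) _.
- exact: CO_GS_step.
- exact: CO_GS_dist.
Qed.

End algorithm.

(** * Conclusion: finite length, convergence and criticality of the limit *)

Theorem mainTheorem3 (R : realType) (L : nat) (H : 'I_L -> euclideanType R)
    (f : hsum H -> R) (psi : forall l, H l -> \bar R)
    (phi : 'I_L -> \bar R -> \bar R)
    (I : nat -> nat) (J : nat -> nat -> {set 'I_L})
    (x : nat -> hsum H) (xt : nat -> nat -> hsum H) (mu : nat -> nat -> R) :
  regular_smooth f ->
  (forall l, regular_block_penalty (psi l)) ->
  (forall l, regular_concave (phi l)) ->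
  quadratic_majorization f ->
  CO_GS f psi phi I J x xt ->
  (forall k l, exists2 i, (i < I k)%N & l \in J k i) ->
  (exists2 Ibar, (0 < Ibar)%N & forall k, (0 < I k <= Ibar)%N) ->
  (exists m : R, forall u, (m%:E <= objective f psi phi u)%E) ->
  bounded_set [set z | exists k i, (i <= I k)%N /\ z = xt k i] ->
  (forall u, dom (objective f psi phi) u ->
    KL_property (objective f psi phi) u) ->
  (forall k i, (i < I k)%N -> 0 < mu k i /\
    strongly_convex_wrt psi (J k i) (mu k i) (majorant f psi phi (x k))) ->
  (exists2 mu_lo, 0 < mu_lo & forall k i, (i < I k)%N -> mu_lo <= mu k i) ->
  cvg (series (fun k => `|x k.+1 - x k|) @ \oo) /\
  exists xhat : hsum H,
    x @ \oo --> xhat /\ limiting_subdiff (objective f psi phi) xhat 0.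
Proof.
move=> [Hf _ Hlip] Hpsi Hphi _ HGS HI [Ibar Ibar0 HIbar] [m Hm] Hbnd HKL Hsc [mu0 mu00 Hmu].
pose S := inner_length I xt; pose v k := objective_fine f psi phi (x k).
pose c := mu0 / 4 / Ibar%:R.
have c0 : 0 < c by rewrite !divr_gt0// ltr0n.
have Dx := CO_GS_dom Hpsi Hphi HGS.
have S0 : forall k, 0 <= S k by exact: inner_length_ge0.
have step : forall k, `|x k.+1 - x k| <= S k := CO_GS_step HGS.
have descent k : c * S k ^+ 2 <= v k - v k.+1.
  apply: (CO_GS_descent Hpsi Hphi HGS (mu := mu)) => // i iI.
  by split; [exact: Hmu|have [] := Hsc k i iI].
have v_anti : nonincreasing_seq v.
  apply/nonincreasing_seqP => k; rewrite -subr_ge0 (le_trans _ (descent k))//.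
  by rewrite mulr_ge0 ?sqr_ge0// ltW.
have v_bound k : m <= v k by rewrite -lee_fin -objectiveE.
have /cvg_ex[/= vhat v_cvg] : cvg (v @ \oo).
  by apply: nonincreasing_is_cvgn => //; exists m => _ [k _ <-].
have [M HM] : exists M, forall k, `|x k| <= M.
  have [M0 [M0r HM0]] := Hbnd; exists (M0 + 1) => k.
  by apply: HM0; [rewrite ltrDl|exists k, 0%N; rewrite (GS_start HGS)].
(* An ultrafilter finer than [\oo] provides the cluster point [xhat] of the bounded iterates. *)
have [G [GU ooG]] := ultraFilterLemma (eventually_filter : ProperFilter \oo).
have GP : ProperFilter G by exact: ultra_proper.
have [xhat xG] := hsum_bounded_ultra_cvg GU HM.
have Dhat := psi_dom_closed Hpsi GP xG Dx.
(* Along [G] the values tend both to [vhat] and to the objective at [xhat]. *)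
have vhatE : vhat = objective_fine f psi phi xhat.
  have vG : v @ G --> vhat by apply: cvg_trans v_cvg; exact: cvg_app.
  exact: (cvg_unique _ vG (objective_fine_cvg Hf Hpsi Hphi GP xG Dx)).
have x_cluster (e : R) N : 0 < e -> exists2 k, (N <= k)%N & `|x k - xhat| < e.
  move=> e0; have GN : G [set k | (N <= k)%N] by apply: ooG; exact: nbhs_infty_ge.
  have Ge : G [set k | `|xhat - x k| < e] by have /cvgrPdist_lt := xG; apply.
  have [k [Nk ke]] := @filter_ex _ G GP _ (filterI GN Ge).
  by exists k => //; rewrite distrC.
have [C C0 [d1 d10 bound]] := CO_GS_subgradient_bound Hpsi Hphi HGS HI Hf Hlip Dhat.
have hatE := objectiveE f Hpsi Hphi Dhat.
have [r [U [h [r0 Uhat hr KL]]]] : KL_property (objective f psi phi) xhat.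
  by apply: HKL; rewrite /dom /= hatE ltry.
have [d2 d20 dU] : exists2 d : R, 0 < d & forall y, `|y - xhat| < d -> U y.
  move: Uhat => /nbhs_ballP[d /= d0 dU]; exists d => // y yd.
  by apply: dU; rewrite -ball_normE /= distrC.
(* By descent [S] tends to 0 with the decrease of [v], so the smallness asked by [bound] holds from
   some [N0] on. *)
have [N0 SN] : exists N, forall k, (N <= k)%N -> S k < d1.
  have cd : 0 < c * d1 ^+ 2 by rewrite mulr_gt0// exprn_gt0.
  have /cvgrPdist_lt/(_ _ cd)[N _ vN] := v_cvg.
  exists N => k Nk; rewrite -ltr_sqr ?nnegrE ?(ltW d10)//.
  rewrite -(ltr_pM2l c0) (le_lt_trans (descent k))//.
  have vge : vhat <= v k.+1.
    rewrite -(cvg_lim _ v_cvg)//; apply: nonincreasing_cvgn_ge => //.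
    by apply/cvg_ex; exists vhat.
  by have := vN k Nk => /ltr_normlP[]; lra.
pose delta := Num.min d1 d2.
have delta0 : 0 < delta by rewrite lt_min d10.
have KLx k : (N0 <= k)%N -> `|x k.+1 - xhat| < delta -> vhat < v k.+1 ->
    ((v k.+1)%:E < vhat%:E + r)%E -> 1 <= derive1 h (v k.+1 - vhat) * (C * S k).
  move=> Nk; rewrite lt_min => /andP[xd1 xd2] vlt vr.
  have [t tx tle] := bound k (SN k Nk) xd1.
  have := KL (x k.+1) (dU _ xd2); rewrite !objectiveE// -vhatE lte_fin.
  move=> /(_ vlt vr) /=.
  have q0 : 0 < derive1 h (v k.+1 - vhat).
    by have [] := desing_C1 hr (t := v k.+1 - vhat); rewrite ?subr_gt0// EFinB lteBlDl.
  move=> kl; rewrite -lee_fin (le_trans kl)// EFinM lee_pmul2l ?lte_fin//.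
  apply: le_trans (dist0_le (limiting_subdiff_frechet tx)) _.
  by rewrite lee_fin.
have S_cvg := KL_summable c0 C0 delta0 r0 hr S0 step descent v_cvg x_cluster KLx.
have x_cvg := KL_cvg c0 C0 delta0 r0 hr S0 step descent v_cvg x_cluster KLx.
split; first exact: series_le_cvg S_cvg.
exists xhat; split=> //.
have [N1 xN1] : exists N, forall k, (N <= k)%N -> `|x k.+1 - xhat| < d1.
  have /cvgrPdist_lt/(_ _ d10)[N _ HN] := x_cvg.
  by exists N => k Nk; rewrite distrC; apply: HN; rewrite /= leqW.
(* The sequences witnessing [limiting_subdiff] start late enough for [bound] to apply at every
   index. *)
pose N := maxn N0 N1.
have /choice[t Ht] n : exists t, frechet_subdiff (objective f psi phi) (x (n + N).+1) t /\
    `|t| <= C * S (n + N)%N.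
  have [t t1 t2] : exists2 t, frechet_subdiff (objective f psi phi) (x (n + N).+1) t &
    `|t| <= C * S (n + N)%N.
    apply: bound; [apply: SN|apply: xN1]; apply: leq_trans (leq_addl n N).
      exact: leq_maxl.
    exact: leq_maxr.
  by exists t.
split; first by rewrite hatE.
have uN : (fun n => (n + N).+1) @ \oo --> \oo.
  by under eq_fun do rewrite -addnS; exact: cvg_addnr.
have u_cvg : x (n + N).+1 @[n --> \oo] --> xhat by apply: cvg_comp uN x_cvg.
exists (fun n => x (n + N).+1), t; split=> //; last by move=> n; have [] := Ht n.
- rewrite hatE.
  under eq_fun do rewrite objectiveE//.
  apply: cvg_EFin; first by apply: nearW.
  exact: (objective_fine_cvg Hf Hpsi Hphi _ u_cvg (fun n => Dx _)).
(* The terms of the convergent series of [S] tend to 0, and with them the subgradients. *)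
- have CS : C * S (n + N)%N @[n --> \oo] --> C * 0.
    apply: cvgM; first exact: cvg_cst.
    exact: (cvg_comp _ _ (cvg_addnr N) (cvg_series_cvg_0 S_cvg)).
  rewrite mulr0 in CS; apply/cvgr0Pnorm_lt => e e0.
  have /cvgrPdist_lt/(_ _ e0) := CS; apply: filterS => n.
  rewrite sub0r normrN; apply: le_lt_trans; have [_ tle] := Ht n.
  by rewrite (le_trans tle)// ler_norm.
Qed.
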